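(* Fix an integer $k\ge2$ and $t\in(0,1]$, and let $A_n\in M_{tnk}(\mathbb C)$ (for $n$ with $tnk\in\mathbb N$) satisfy $\operatorname{Tr}[A_nA_n^*]=1$, Assumption 1 ($\operatorname{Tr}[A_n]/\sqrt{tnk}=m+O(n^{-2})$ for some $m\in\mathbb C$) and Assumption 2 ($\|A_n\|_\infty=O(n^{-1/2})$). Let $|\psi_n\rangle=\sum_{i,j}(A_n)_{ij}|i\rangle|j\rangle$ and $Z_n=(\Phi_n^C\otimes\Phi_n^C)(|\psi_n\rangle\langle\psi_n|)\in M_{k^2}(\mathbb C)$ (two identical copies of the same random channel). Then the empirical eigenvalue distribution of $Z_n$ converges (almost surely) to $\delta_{1/k^2}$; in particular $\mathbb E\operatorname{Tr}[Z_n^p]\to k^{2}(k^{-2})^p$ for all $p\ge1$.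
   Context: Random channel model: $U$ Haar-distributed in $\mathcal U(nk)$ acting on $\mathbb C^k\otimes\mathbb C^n$; $V:\mathbb C^{tnk}\to\mathbb C^k\otimes\mathbb C^n$ the isometry given by the first $tnk$ columns of $U$; $\Phi_n^C(\rho)=\operatorname{Tr}_{\mathbb C^n}[V\rho V^*]\in M_k(\mathbb C)$. Both tensor factors use the same $V$. *)

(* Defs.v *)
From HB Require Import structures.
From mathcomp Require Import all_boot all_order all_algebra.
From mathcomp Require Import all_classical all_reals all_analysis.
From mathcomp Require Import complex mxtens.
Set Implicit Arguments. Unset Strict Implicit. Unset Printing Implicit Defensive.
Import Order.TTheory GRing.Theory Num.Theory.
Import numFieldTopology.Exports.
Local Open Scope ring_scope.

(* Euclidean topology on C = R[i] (the metric topology of the complex modulus),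
   hence on complex matrices. *)
HB.instance Definition _ (R : realType) := PseudoPointedMetric.copy R[i] R[i]^o.

Definition adjm (R : realType) (m n : nat) (A : 'M[R[i]]_(m, n)) : 'M[R[i]]_(n, m) :=
  (map_mx conjc A)^T.

Definition unitary (R : realType) (N : nat) (W : 'M[R[i]]_N) : Prop :=
  W *m adjm W = 1%:M.

(* The first r columns of a matrix M (columns with index >= q are filled with 0;
   this never happens when r <= q). *)
Definition firstcols (R : realType) (p q r : nat) (M : 'M[R[i]]_(p, q)) : 'M[R[i]]_(p, r) :=
  \matrix_(a, j) (if @insub _ (fun x => x < q)%N _ (nat_of_ord j) is Some j' then M a j' else 0).

(* Tensor products: C^m (x) C^n is identified with C^(m*n) via mathcomp-real-closed's
   mxtens_index ((a,b) |-> a*n + b), the convention used by the Kronecker product [*t]. *)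

Definition psi_vec (R : realType) (d : nat) (A : 'M[R[i]]_d) : 'cV[R[i]]_(d * d) :=
  \col_p A (mxtens_unindex p).1 (mxtens_unindex p).2.

Definition ptrace2 (R : realType) (m n : nat) (X : 'M[R[i]]_(m * n)) : 'M[R[i]]_m :=
  \matrix_(a, a') \sum_(b < n) X (mxtens_index (a, b)) (mxtens_index (a', b)).

Definition PhiC (R : realType) (k n d : nat) (V : 'M[R[i]]_(k * n, d)) (rho : 'M[R[i]]_d)
  : 'M[R[i]]_k := ptrace2 (V *m rho *m adjm V).

(* Partial trace over both C^n factors of (C^k (x) C^n) (x) (C^k (x) C^n),
   landing in C^k (x) C^k. *)
Definition ptrace_nn (R : realType) (k n : nat) (Y : 'M[R[i]]_((k * n) * (k * n)))
  : 'M[R[i]]_(k * k) :=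
  \matrix_(p, q)
    \sum_(b < n) \sum_(b' < n)
      Y (mxtens_index (mxtens_index ((mxtens_unindex p).1, b),
                       mxtens_index ((mxtens_unindex p).2, b')))
        (mxtens_index (mxtens_index ((mxtens_unindex q).1, b),
                       mxtens_index ((mxtens_unindex q).2, b'))).

Definition PhiC_tens (R : realType) (k n d : nat) (V : 'M[R[i]]_(k * n, d))
  (X : 'M[R[i]]_(d * d)) : 'M[R[i]]_(k * k) :=
  ptrace_nn (((V *t V) *m X) *m adjm (V *t V)).

Lemma char_poly_splits (R : realType) (m : nat) (A : 'M[R[i]]_m) :
  exists s : seq R[i], char_poly A == \prod_(z <- s) ('X - z%:P).
Proof.
have [s Hs] := closed_field_poly_normal (char_poly A).
by exists s; apply/eqP; rewrite Hs (monicP (char_poly_monic A)) scale1r.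
Qed.

Definition eigs (R : realType) (m : nat) (A : 'M[R[i]]_m) : seq R[i] :=
  xchoose (char_poly_splits A).

Definition emp_eig (R : realType) (m : nat) (A : 'M[R[i]]_m) (f : R[i] -> R) : R :=
  (m%:R)^-1 * \sum_(z <- eigs A) f z.

Definition vnorm2 (R : realType) (m : nat) (v : 'cV[R[i]]_m) : R :=
  Num.sqrt (\sum_i (complex.Re (v i 0 * conjc (v i 0)))).

Definition opnorm (R : realType) (m n : nat) (A : 'M[R[i]]_(m, n)) : R :=
  sup [set vnorm2 (A *m v) | v in [set v : 'cV[R[i]]_n | vnorm2 v <= 1]].

Definition haar_unitary (R : realType) (d : measure_display) (Omega : measurableType d)
  (P : probability Omega R) (N : nat) (U : Omega -> 'M[R[i]]_N) : Prop :=
  [/\ (forall w, unitary (U w)),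
      (forall a b, measurable_fun setT (fun w => complex.Re (U w a b)) /\
                   measurable_fun setT (fun w => complex.Im (U w a b))) &
      (forall W : 'M[R[i]]_N, unitary W ->
         forall g : 'M[R[i]]_N -> R, continuous g -> (exists M, forall x, `|g x| <= M) ->
           (\int[P]_w (g (W *m U w))%:E = \int[P]_w (g (U w))%:E)%E)].

Definition cvg_along (R : realType) (S : nat -> Prop) (u : nat -> R) (l : R) : Prop :=
  forall e : R, 0 < e -> exists N : nat, forall n, S n -> (N <= n)%N -> `|u n - l| < e.

(* Main.v *)
Require Import Defs.
From HB Require Import structures.
From mathcomp Require Import all_boot all_order all_algebra.
From mathcomp Require Import cyclic separable cyclotomic.
From mathcomp Require Import all_classical all_reals all_analysis.
From mathcomp Require Import measurable_realfun.
From mathcomp Require Import complex mxtens.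
From mathcomp Require Import ring lra zify.
Set Implicit Arguments. Unset Strict Implicit. Unset Printing Implicit Defensive.
Import Order.TTheory GRing.Theory Num.Theory.
Import numFieldTopology.Exports.
Local Open Scope ring_scope.

(* Averaging the channel output over finitely many left multiplications is already enough.
   With [C] the zero-padded [A_n] and [B = U C U^T], the entries of [Z_n] are sums
   [sum_{b,b'} B_{(i,b),(j,b')} conj B_{(i',b),(j',b')}].  Haar invariance allows replacing [U] by
   [G D G D' U], where [G] is a fixed flat unitary matrix whose columns are maximally entangled
   and [D], [D'] are diagonal with independent uniform fourth roots of unity on the diagonal.
   For every fixed [U] the mean of an entry over [D, D'] is explicit and equals that of
   [I / k^2] up to O(1/n).  Changing one diagonal coefficient changes [B] by a rank two
   matrix, hence an entry by O(|A_n|^2) = O(1/n); there are 2kn coefficients, so a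
   martingale argument bounds the centered fourth moment by O(1/n^2).  This is summable,
   which gives almost sure convergence [Z_n -> I / k^2], hence that of the spectrum and of
   the moments. *)

(** * Averages over finite families of unitary matrices *)

(** Haar measure is known only through the integrals of bounded continuous functions, which left
    multiplication by a fixed unitary preserves. Hence the use of finite averages, and of truncation
    for polynomial integrands. One layer [G D] would not suffice. Averaging over [D] kills each
    product [B_{xy} conj B_{x'y'}] unless [(x',y')] is [(x,y)] or the swap [(y,x)]. The unswapped
    products yield exactly the entry of [I / k^2], by maximal entanglement of the columns of [G].
    The swaps survive because both copies use the same [V], and for an individual [U] their sum can
    be of order one. The layer [G D'], acting on [U] before the other, spreads [B] out: flatness of
    [G] gives every product a mean O(1/N^2), [N = kn], whereas the swap coefficients have total
    modulus at most [n]. A variance bound would not do: bounded differences make it only O(1/n),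
    which is not summable. *)

Section Averages.
Context {R : realType} {N : nat}.
Implicit Types (l : seq 'M[R[i]]_N) (s : seq (seq 'M[R[i]]_N)) (Y : 'M[R[i]]_N).

Definition avg {K : numFieldType} l (g : 'M[R[i]]_N -> K) Y : K :=
  (\sum_(M <- l) g (M *m Y)) / (size l)%:R.

(** The head of the list is the outermost left factor: for families [l1, ..., lr] this is the mean
    of [g (M1 *m ... *m Mr *m Y)] over independent [Mi] in [li]. Peeling off [l1] replaces [g] by a
    conditional mean, which is the martingale step of the moment bounds. *)
Fixpoint avgs {K : numFieldType} s (g : 'M[R[i]]_N -> K) : 'M[R[i]]_N -> K :=
  if s is l :: s' then avgs s' (avg l g) else g.

Definition unitary_family l := l <> [::] /\ {in l, forall M, unitary M}.
Definition unitary_families s := {in s, forall l, unitary_family l}.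

Lemma unitary_families_cons l s :
  unitary_families (l :: s) -> unitary_family l /\ unitary_families s.
Proof.
move=> h; split; first by apply: h; rewrite mem_head.
by move=> l' l's; apply: h; rewrite inE l's orbT.
Qed.

Lemma unitary_families_cat s1 s2 :
  unitary_families s1 -> unitary_families s2 -> unitary_families (s1 ++ s2).
Proof. by move=> h1 h2 l; rewrite mem_cat => /orP[/h1|/h2]. Qed.

Lemma unitary1 : unitary (1%:M : 'M[R[i]]_N).
Proof. by rewrite /unitary /adjm map_mx1 trmx1 mulmx1. Qed.

Lemma adjmM m n p (A : 'M[R[i]]_(m, n)) (B : 'M[R[i]]_(n, p)) :
  adjm (A *m B) = adjm B *m adjm A.
Proof. by rewrite /adjm map_mxM trmx_mul. Qed.

Lemma unitaryM (W Y : 'M[R[i]]_N) : unitary W -> unitary Y -> unitary (W *m Y).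
Proof.
by move=> hW hY; rewrite /unitary adjmM -mulmxA (mulmxA Y) hY mul1mx hW.
Qed.

Lemma unitary_adj (W : 'M[R[i]]_N) : unitary W -> adjm W *m W = 1%:M.
Proof. exact: mulmx1C. Qed.

Lemma avgs_cat {K : numFieldType} s1 s2 (g : 'M[R[i]]_N -> K) :
  avgs (s1 ++ s2) g = avgs s2 (avgs s1 g).
Proof. by elim: s1 g => //= l s1 IH g; rewrite IH. Qed.

Lemma avg_ext {K : numFieldType} l (g h : 'M[R[i]]_N -> K) Y :
  unitary_family l -> unitary Y -> (forall W, unitary W -> g W = h W) ->
  avg l g Y = avg l h Y.
Proof.
move=> [_ lU] uY gh; congr (_ / _).
by apply: eq_big_seq => M Ml; rewrite gh //; apply: unitaryM => //; exact: lU.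
Qed.

Lemma avgs_ext {K : numFieldType} s (g h : 'M[R[i]]_N -> K) Y :
  unitary_families s -> unitary Y -> (forall W, unitary W -> g W = h W) ->
  avgs s g Y = avgs s h Y.
Proof.
elim: s g h => /= [|l s IH] g h; first by move=> _ uY; exact.
move=> /unitary_families_cons[lU sU] uY gh; apply: IH => // W uW.
exact: avg_ext.
Qed.

Lemma avg_sum {K : numFieldType} {I : Type} l (r : seq I) (P : pred I)
    (a : I -> K) (g : I -> 'M[R[i]]_N -> K) :
  avg l (fun Y => \sum_(i <- r | P i) a i * g i Y) =
  fun Y => \sum_(i <- r | P i) a i * avg l (g i) Y.
Proof.
apply/funext => Y; rewrite /avg exchange_big /= mulr_suml.
by apply: eq_bigr => i _; rewrite -mulr_sumr mulrA.
Qed.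

Lemma avgs_sum {K : numFieldType} {I : Type} s (r : seq I) (P : pred I)
    (a : I -> K) (g : I -> 'M[R[i]]_N -> K) Y :
  avgs s (fun Y => \sum_(i <- r | P i) a i * g i Y) Y =
  \sum_(i <- r | P i) a i * avgs s (g i) Y.
Proof. by elim: s g => //= l s IH g; rewrite avg_sum IH. Qed.

Lemma size_gt0 l : unitary_family l -> 0 < (size l)%:R :> R.
Proof. by case: l => [[]//|M l _]; rewrite ltr0n. Qed.

Lemma size_neq0 {K : numFieldType} l : unitary_family l -> (size l)%:R != 0 :> K.
Proof. by case: l => [[]//|M l _]; rewrite pnatr_eq0. Qed.

Lemma avg_cst {K : numFieldType} l (c : K) Y :
  unitary_family l -> avg l (fun=> c) Y = c.
Proof.
move=> lU; rewrite /avg big_const_seq count_predT iter_addr_0.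
by rewrite -[c *+ _]mulr_natr mulfK // size_neq0.
Qed.

Lemma avgs_cst {K : numFieldType} s (c : K) Y :
  unitary_families s -> avgs s (fun=> c) Y = c.
Proof.
elim: s => //= l s IH /unitary_families_cons[lU sU].
by rewrite -[RHS]IH //; congr (avgs s _ Y); apply/funext => W; rewrite avg_cst.
Qed.

Lemma avgsD {K : numFieldType} s (g h : 'M[R[i]]_N -> K) Y :
  avgs s (fun W => g W + h W) Y = avgs s g Y + avgs s h Y.
Proof.
elim: s g h => //= l s IH g h; rewrite -IH; congr (avgs s _ Y).
by apply/funext => W; rewrite /avg big_split mulrDl.
Qed.

Lemma avgsZ {K : numFieldType} s (a : K) (g : 'M[R[i]]_N -> K) Y :
  avgs s (fun W => a * g W) Y = a * avgs s g Y.
Proof.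
elim: s g => //= l s IH g; rewrite -IH; congr (avgs s _ Y).
by apply/funext => W; rewrite /avg -mulr_sumr mulrA.
Qed.

Lemma avg_le l (g h : 'M[R[i]]_N -> R) Y :
  unitary_family l -> unitary Y -> (forall W, unitary W -> g W <= h W) ->
  avg l g Y <= avg l h Y.
Proof.
move=> [_ lU] uY gh; rewrite ler_wpM2r ?invr_ge0 //.
rewrite [leLHS]big_seq [leRHS]big_seq; apply: ler_sum => M Ml.
by apply: gh; apply: unitaryM => //; exact: lU.
Qed.

Lemma avgs_le s (g h : 'M[R[i]]_N -> R) Y :
  unitary_families s -> unitary Y -> (forall W, unitary W -> g W <= h W) ->
  avgs s g Y <= avgs s h Y.
Proof.
elim: s g h => /= [|l s IH] g h; first by move=> _ uY; exact.
move=> /unitary_families_cons[lU sU] uY gh; apply: IH => // W uW.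
exact: avg_le.
Qed.

(** The multipliers on both sides make the notion stable: [K] absorbs the factors already averaged
    out, [K'] stands for the factors still to come. *)
Definition bounded_difference (d : R) l (g : 'M[R[i]]_N -> R) :=
  forall K K', unitary K -> unitary K' ->
    {in l &, forall M M', `|g (K *m M *m K') - g (K *m M' *m K')| <= d}.

Lemma bounded_difference_avg d l l' g : unitary_family l' ->
  bounded_difference d l g -> bounded_difference d l (avg l' g).
Proof.
move=> l'U gl K K' uK uK' M M' Ml M'l.
have s0 : 0 < (size l')%:R :> R by exact: size_gt0.
rewrite /avg -mulrBl -sumrB normrM (ger0_norm (x := _^-1)) ?invr_ge0 ?ler0n//.
rewrite ler_pdivrMr //; apply: (le_trans (ler_norm_sum _ _ _)).
apply: (@le_trans _ _ (\sum_(L <- l') d)).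
  rewrite big_seq [leRHS]big_seq; apply: ler_sum => L Ll.
  rewrite !mulmxA; apply: gl => //; apply: unitaryM => //.
  by case: l'U => _; exact.
by rewrite big_const_seq count_predT iter_addr_0 mulr_natr.
Qed.

Lemma avg_diff d l g Y M : unitary_family l -> unitary Y ->
  bounded_difference d l g -> M \in l -> `|g (M *m Y) - avg l g Y| <= d.
Proof.
move=> lU uY gl Ml.
have s0 : 0 < (size l)%:R :> R by exact: size_gt0.
have -> : g (M *m Y) - avg l g Y =
    (\sum_(L <- l) (g (M *m Y) - g (L *m Y))) / (size l)%:R.
  rewrite sumrB mulrBl; congr (_ - _).
  by rewrite big_const_seq count_predT iter_addr_0 -[_ *+ _]mulr_natr mulfK ?gt_eqF.
rewrite normrM (ger0_norm (x := _^-1)) ?invr_ge0 ?ler0n//.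
rewrite ler_pdivrMr //; apply: (le_trans (ler_norm_sum _ _ _)).
apply: (@le_trans _ _ (\sum_(L <- l) d)).
  rewrite big_seq [leRHS]big_seq; apply: ler_sum => L Ll.
  by have := gl _ _ unitary1 uY _ _ Ml Ll; rewrite !mul1mx.
by rewrite big_const_seq count_predT iter_addr_0 mulr_natr.
Qed.

Lemma avg_centered l g Y : unitary_family l ->
  \sum_(M <- l) (g (M *m Y) - avg l g Y) = 0 :> R.
Proof.
move=> lU; rewrite sumrB big_const_seq count_predT iter_addr_0.
by rewrite -[_ *+ _]mulr_natr /avg divfK ?size_neq0 // subrr.
Qed.

(** Deviations from the mean sum to zero, so a term linear in the deviation costs nothing and only
    the constant [a] survives. *)
Lemma avg_poly_le d l g Y (a b c : R) (F : R -> R) :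
  unitary_family l -> unitary Y -> bounded_difference d l g ->
  (forall x, `|x| <= d -> F (avg l g Y + x) <= a + b * x) ->
  avg l (F \o g) Y <= a.
Proof.
move=> lU uY gl Fab.
rewrite /avg ler_pdivrMr ?size_gt0 //.
apply: (@le_trans _ _ (\sum_(M <- l) (a + b * (g (M *m Y) - avg l g Y)))).
  rewrite big_seq [leRHS]big_seq; apply: ler_sum => M Ml /=.
  have := Fab _ (avg_diff lU uY gl Ml).
  by rewrite addrCA subrr addr0.
rewrite big_split /= -mulr_sumr avg_centered // mulr0 addr0.
by rewrite big_const_seq count_predT iter_addr_0 -[_ *+ _]mulr_natr.
Qed.

(** Orthogonality of martingale increments: the cross term of the square is linear in the centered
    increment, so each family adds at most [d ^+ 2]. *)
Lemma avgs_second_moment d s g Y (c : R) : 0 <= d ->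
  unitary_families s -> unitary Y -> {in s, forall l, bounded_difference d l g} ->
  avgs s (fun W => (g W - c) ^+ 2) Y <= (avgs s g Y - c) ^+ 2 + (size s)%:R * d ^+ 2.
Proof.
move=> d0; elim: s g => /= [|l s IH] g; first by rewrite mul0r addr0.
move=> /unitary_families_cons[lU sU] uY gd.
have gl : bounded_difference d l g by apply: gd; rewrite mem_head.
have gs : {in s, forall l', bounded_difference d l' (avg l g)}.
  move=> l' l's; apply: bounded_difference_avg => //.
  by apply: gd; rewrite inE l's orbT.
apply: (@le_trans _ _ (avgs s (fun W => (avg l g W - c) ^+ 2 + d ^+ 2) Y)).
  apply: avgs_le => // W uW.
  pose b := 2 * (avg l g W - c).
  apply: (@avg_poly_le d l g W _ b 0 (fun y => (y - c) ^+ 2)) => // x xd.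
  have : x ^+ 2 <= d ^+ 2 by rewrite -real_normK ?num_real // lerXn2r ?nnegrE.
  by rewrite /b; set z := avg l g W; nra.
rewrite avgsD avgs_cst // -natr1 mulrDl mul1r addrA lerD2r.
exact: IH.
Qed.

(* Pointwise [(G + x)^4 <= G^4 + 4 G^3 x + 8 G^2 d^2 + 3 d^4] for [|x| <= d]; the
   linear term averages to 0, and the second moment of [G] is at most [size s * d^2]. *)
Lemma avgs_fourth_moment d s g Y : 0 <= d ->
  unitary_families s -> unitary Y -> {in s, forall l, bounded_difference d l g} ->
  avgs s (fun W => (g W - avgs s g Y) ^+ 4) Y <= 4 * ((size s)%:R * d ^+ 2) ^+ 2.
Proof.
move=> d0; elim: s g => /= [|l s IH] g.
  by rewrite subrr mul0r !expr0n /= mulr0.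
move=> /unitary_families_cons[lU sU] uY gd.
have gl : bounded_difference d l g by apply: gd; rewrite mem_head.
have gs : {in s, forall l', bounded_difference d l' (avg l g)}.
  move=> l' l's; apply: bounded_difference_avg => //.
  by apply: gd; rewrite inE l's orbT.
set c := avgs s (avg l g) Y.
apply: (@le_trans _ _ (avgs s (fun W =>
    ((avg l g W - c) ^+ 4 + 8 * d ^+ 2 * (avg l g W - c) ^+ 2) + 3 * d ^+ 4) Y)).
  apply: avgs_le => // W uW.
  pose b := 4 * (avg l g W - c) ^+ 3.
  apply: (@avg_poly_le d l g W _ b 0 (fun y => (y - c) ^+ 4)) => // x xd.
  have x2 : x ^+ 2 <= d ^+ 2 by rewrite -real_normK ?num_real // lerXn2r ?nnegrE.
  have x4 : x ^+ 4 <= d ^+ 4.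
    by rewrite -[4%N]/(2 * 2)%N !exprM lerXn2r ?nnegrE ?sqr_ge0.
  rewrite /b.
  have -> : avg l g W + x - c = (avg l g W - c) + x by ring.
  set G := avg l g W - c.
  have h1 : 0 <= (G * x - x ^+ 2) ^+ 2 by exact: sqr_ge0.
  have h2 : G ^+ 2 * x ^+ 2 <= G ^+ 2 * d ^+ 2 by rewrite ler_wpM2l ?sqr_ge0.
  (* The odd term [4 G x^3] is absorbed into the even ones through [(G x - x^2)^2 >= 0]. *)
  have e : (G + x) ^+ 4 = G ^+ 4 + 4 * G ^+ 3 * x + 8 * (G ^+ 2 * x ^+ 2)
      + 3 * x ^+ 4 - 2 * (G * x - x ^+ 2) ^+ 2 by ring.
  by rewrite e; lra.
rewrite avgsD avgs_cst // avgsD avgsZ.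
have h4 := IH _ sU uY gs; rewrite -/c in h4.
have h2 := avgs_second_moment c d0 sU uY gs.
rewrite -/c subrr expr0n /= add0r in h2.
have h3 : 8 * d ^+ 2 * avgs s (fun W => (avg l g W - c) ^+ 2) Y <=
          8 * d ^+ 2 * ((size s)%:R * d ^+ 2).
  by rewrite ler_wpM2l // mulr_ge0 ?sqr_ge0.
apply: (le_trans (lerD (lerD h4 h3) (lexx _))).
(* The constant 4 closes the recursion: passing from [m] to [m + 1] families provides
   [8 m d^4 + 4 d^4], while [8 m d^4 + 3 d^4] is required. *)
rewrite -[(size s).+1%:R]natr1; set m := (size s)%:R.
have : 0 <= d ^+ 4 by apply: exprn_ge0.
have -> : 4 * ((m + 1) * d ^+ 2) ^+ 2 = 4 * (m * d ^+ 2) ^+ 2 +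
   8 * d ^+ 2 * (m * d ^+ 2) + 4 * d ^+ 4 by ring.
by lra.
Qed.

End Averages.

(** * Bounded differences *)

Section Norms.
Context {R : realType}.
Local Notation C := R[i].

Lemma sqr_normc (z : C) : `|z| ^+ 2 = z * conjc z.
Proof. exact: normCK. Qed.

Lemma norm_conjc (z : C) : `|conjc z| = `|z|.
Proof. exact: norm_conjC. Qed.

Lemma conjc_sum (I : Type) (r : seq I) (Q : pred I) (F : I -> C) :
  conjc (\sum_(j <- r | Q j) F j) = \sum_(j <- r | Q j) conjc (F j).
Proof. exact: (rmorph_sum (@conjc R)). Qed.

Lemma conjcM (a b : C) : conjc (a * b) = conjc a * conjc b.
Proof. exact: (rmorphM (@conjc R)). Qed.

Lemma norm_Re_le (z : C) : (`|complex.Re z|)%:C%C <= `|z|.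
Proof.
case: z => a b /=; rewrite normc_def lecR /= -sqrtr_sqr.
by rewrite ler_wsqrtr // lerDl sqr_ge0.
Qed.

Lemma norm_Im_le (z : C) : (`|complex.Im z|)%:C%C <= `|z|.
Proof.
case: z => a b /=; rewrite normc_def lecR /= -sqrtr_sqr.
by rewrite ler_wsqrtr // lerDr sqr_ge0.
Qed.

Lemma norm_le_ReIm (z : C) :
  `|z| <= (`|complex.Re z| + `|complex.Im z|)%:C%C.
Proof.
rewrite {1}(complexE z) (le_trans (ler_normD _ _)) // rmorphD /= normrM.
rewrite !normc_def /= !expr0n /= expr1n addr0 add0r sqrtr1.
by rewrite !addr0 !sqrtr_sqr mul1r.
Qed.

(** Lagrange's identity for the moduli: after doubling, the two sides differ by the sum of the
    squares [(|x_a| |y_b| - |x_b| |y_a|)^2]. *)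
Lemma sumCS (I : finType) (x y : I -> C) :
  `|\sum_a x a * y a| ^+ 2 <= (\sum_a `|x a| ^+ 2) * (\sum_a `|y a| ^+ 2).
Proof.
apply: (@le_trans _ _ ((\sum_a `|x a| * `|y a|) ^+ 2)).
  rewrite lerXn2r ?nnegrE //.
    by apply: sumr_ge0 => a _; rewrite mulr_ge0.
  by rewrite (le_trans (ler_norm_sum _ _ _)) //; apply: ler_sum => a _; rewrite normrM.
rewrite -(@ler_pM2l _ 2) // expr2 !big_distrlr /=.
rewrite (_ : 2 * (\sum_a \sum_b `|x a| ^+ 2 * `|y b| ^+ 2) =
  \sum_a \sum_b ((`|x a| * `|y b|) ^+ 2 + (`|x b| * `|y a|) ^+ 2)); last first.
  rewrite mulr_natl mulr2n {2}exchange_big /= -big_split; apply: eq_bigr => a _.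
  by rewrite -big_split; apply: eq_bigr => b _ /=; rewrite !exprMn.
rewrite mulr_sumr; apply: ler_sum => a _; rewrite mulr_sumr; apply: ler_sum => b _.
rewrite -subr_ge0 (_ : _ - _ = (`|x a| * `|y b| - `|x b| * `|y a|) ^+ 2); last by ring.
by apply: real_exprn_even_ge0 => //; rewrite realB // realM // normr_real.
Qed.

Definition l2 {m} (v : 'cV[C]_m) : C := \sum_a `|v a 0| ^+ 2.

Lemma l2_ge0 m (v : 'cV[C]_m) : 0 <= l2 v.
Proof. by apply: sumr_ge0 => a _; rewrite exprn_ge0. Qed.

Lemma l2E m (v : 'cV[C]_m) : l2 v = (adjm v *m v) 0 0.
Proof. by rewrite mxE; apply: eq_bigr => a _; rewrite !mxE sqr_normc mulrC. Qed.

Lemma l2_unitary m (W : 'M[C]_m) (v : 'cV[C]_m) : unitary W -> l2 (W *m v) = l2 v.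
Proof. by move=> uW; rewrite !l2E adjmM -mulmxA (mulmxA (adjm W)) unitary_adj // mul1mx. Qed.

Lemma adjm_tr m n (A : 'M[C]_(m, n)) : adjm A^T = (adjm A)^T.
Proof. by apply/matrixP => a b; rewrite !mxE. Qed.

Lemma unitary_tr m (W : 'M[C]_m) : unitary W -> unitary W^T.
Proof. by move=> uW; rewrite /unitary adjm_tr -trmx_mul unitary_adj // trmx1. Qed.

Lemma l2_delta m (x : 'I_m) : l2 (delta_mx x 0) = 1.
Proof.
rewrite /l2 (bigD1 x) //= big1 => [|a ax]; first by rewrite !mxE !eqxx normr1 expr1n addr0.
by rewrite !mxE (negbTE ax) normr0 expr0n.
Qed.

Lemma sum_injective_le (n m : nat) (f : 'I_n -> 'I_m) (F : 'I_m -> C) :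
  injective f -> (forall p, 0 <= F p) -> \sum_b F (f b) <= \sum_p F p.
Proof.
move=> fI F0; rewrite (_ : \sum_b F (f b) = \sum_(p in codom f) F p).
  by rewrite [leRHS](bigID (mem (codom f))) /= lerDl; apply: sumr_ge0.
by rewrite -big_uniq ?(map_inj_uniq fI) ?enum_uniq //= /codom big_image.
Qed.

End Norms.

(** * Random phases on one coordinate *)

Section Phases.
Context {R : realType} {N : nat}.
Local Notation C := R[i].

Definition phase (x : 'I_N) (c : C) : 'M[C]_N :=
  diag_mx (\row_j (if j == x then c else 1)).

(** In the products to be averaged, a diagonal coefficient occurs with an exponent between -2 and 2.
    Averaging over fourth roots of unity kills all nonzero exponents in this range; signs would let
    2 and -2 survive. *)
Definition fourth_roots : seq C := [:: 1; 'i%C; -1; - 'i%C].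

Lemma fourth_root_norm c : c \in fourth_roots -> c * conjc c = 1.
Proof.
have ii : 'i%C * - 'i%C = 1 :> C by rewrite mulrN -expr2 sqr_i opprK.
have ci : conjc 'i%C = - 'i%C :> C by rewrite /= ; simpc.
have c1 : conjc 1 = 1 :> C by exact: conjc1.
have cN (z : C) : conjc (- z) = - conjc z by exact: rmorphN.
rewrite !inE => /or4P[] /eqP ->; rewrite ?cN ?c1 ?ci ?mulr1 ?mulrNN ?mulr1 ?opprK ?mulNr -?mulrN //.
Qed.

Definition phase_family (x : 'I_N) : seq 'M[C]_N := [seq phase x c | c <- fourth_roots].

Definition phase_families : seq (seq 'M[C]_N) := [seq phase_family x | x <- enum 'I_N].

Lemma unitary_phase x c : c \in fourth_roots -> unitary (phase x c).
Proof.
move=> cr; rewrite /unitary /adjm map_diag_mx tr_diag_mx mulmx_diag.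
apply/matrixP => a b; rewrite !mxE; have [_|_] := eqVneq a b; last by rewrite !mulr0n.
rewrite !mulr1n; case: eqP => _; first by rewrite fourth_root_norm.
by rewrite -[LHS]/(1 * conjc 1) conjc1 mulr1.
Qed.

Lemma unitary_phase_families : unitary_families phase_families.
Proof.
move=> l /mapP[x _ ->]; split => // M /mapP[c cr ->]; exact: unitary_phase.
Qed.

Lemma unitary_family1 (G : 'M[C]_N) : unitary G -> unitary_family [:: G].
Proof. by move=> uG; split => // M; rewrite inE => /eqP ->. Qed.

End Phases.

(** * Effect of one phase on an output entry *)

Section BoundedDifference.
Context {R : realType} {n N : nat}.
Local Notation C := R[i].
Variables (A : 'M[C]_N) (kappa : R).
Hypothesis kappa0 : 0 <= kappa.
Hypothesis opA : forall v : 'cV[C]_N, l2 (A *m v) <= kappa%:C%C * l2 v.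

Definition conj_tr (Y : 'M[C]_N) : 'M[C]_N := Y *m A *m Y^T.

(** When the four maps are row blocks of [C^k (x) C^n] and [B1 = B2 = B], this is an entry of the
    partial trace of the projector onto the vectorised [B]. Keeping two arguments lets them be
    changed one at a time. *)
Definition pairing (a a' b b' : 'I_n -> 'I_N) (B1 B2 : 'M[C]_N) : C :=
  \sum_x \sum_y B1 (a x) (b y) * conjc (B2 (a' x) (b' y)).

Lemma pairingC a a' b b' B1 B2 :
  pairing a a' b b' B1 B2 = conjc (pairing a' a b' b B2 B1).
Proof.
rewrite /pairing conjc_sum; apply: eq_bigr => x _; rewrite conjc_sum.
by apply: eq_bigr => y _; rewrite conjcM conjcK mulrC.
Qed.

Lemma bilinear_bound (u v : 'cV[C]_N) :
  `|(u^T *m A *m v) 0 0| ^+ 2 <= kappa%:C%C * l2 u * l2 v.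
Proof.
rewrite -mulmxA mxE; apply: (le_trans (sumCS _ _)).
rewrite (_ : \sum_a `|u^T 0 a| ^+ 2 = l2 u).
  by rewrite -mulrA mulrCA; apply: ler_wpM2l (opA v); exact: l2_ge0.
by apply: eq_bigr => a _; rewrite mxE.
Qed.

(** The transpose inherits the bound by duality: for [z = l2 (A^T w)], testing the bilinear form
    against the conjugate of [A^T w] gives [z^2 <= kappa * l2 w * z], and [z] cancels. *)
Lemma l2_tr_bound (w : 'cV[C]_N) : l2 (w^T *m A)^T <= kappa%:C%C * l2 w.
Proof.
set z := l2 _; pose v : 'cV[C]_N := map_mx conjc (w^T *m A)^T.
have zE : (w^T *m A *m v) 0 0 = z.
  by rewrite mxE; apply: eq_bigr => a _; rewrite sqr_normc; congr (_ * _); rewrite !mxE.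
have vE : l2 v = z by apply: eq_bigr => a _; rewrite [v _ _]mxE norm_conjc.
have := bilinear_bound w v; rewrite zE vE ger0_norm ?l2_ge0 // expr2.
have [->|z0] := eqVneq z 0; first by move=> _; rewrite mulr_ge0 ?l2_ge0 // ler0c.
by rewrite ler_pM2r // lt0r z0 l2_ge0.
Qed.

Lemma l2_conj_row (n' : nat) (f : 'I_n' -> 'I_N) (x : 'I_n' -> C) : injective f ->
  l2 (\col_p \sum_b (p == f b)%:R * x b) = \sum_b `|x b| ^+ 2.
Proof.
move=> fI; rewrite /l2.
under eq_bigr => p _.
  rewrite mxE sqr_normc conjc_sum big_distrlr /=.
  under eq_bigr => b _.
    rewrite (bigD1 b) //= big1 ?addr0 => [|c cb]; last first.
      rewrite conjcM conjc_nat; have [pb|] := eqVneq p (f b); last by rewrite !mul0r.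
      by rewrite pb (inj_eq fI) eq_sym (negbTE cb) mul0r mulr0.
    over.
  over.
rewrite exchange_big /=; apply: eq_bigr => b _.
rewrite (bigD1 (f b)) //= big1 ?addr0 => [|p pb].
  by rewrite eqxx !mul1r sqr_normc.
by rewrite (negbTE pb) !mul0r.
Qed.

(** Against a rank one matrix the double sum collapses to a single value of the bilinear form of
    [A], at the images under [Y^T] of vectors that carry the conjugated coordinates of [p] and [q]
    from the blocks [a], [b] to [a'], [b']. Injectivity keeps their norms from growing, so no factor
    [n] appears. *)
Lemma pairing_rank1 a a' b b' (p q : 'cV[C]_N) (Y : 'M[C]_N) :
  injective a -> injective a' -> injective b -> injective b' -> unitary Y ->
  `|pairing a a' b b' (p *m q^T) (conj_tr Y)| ^+ 2 <= kappa%:C%C * l2 p * l2 q.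
Proof.
move=> aI a'I bI b'I uY.
pose u : 'cV[C]_N := \col_r \sum_x (r == a' x)%:R * conjc (p (a x) 0).
pose v : 'cV[C]_N := \col_r \sum_x (r == b' x)%:R * conjc (q (b x) 0).
have -> : pairing a a' b b' (p *m q^T) (conj_tr Y) =
    conjc (((Y^T *m u)^T *m A *m (Y^T *m v)) 0 0).
  rewrite trmx_mul trmxK.
  have -> : u^T *m Y *m A *m (Y^T *m v) = u^T *m (conj_tr Y *m v).
    by rewrite /conj_tr !mulmxA.
  set B := conj_tr Y.
  rewrite /pairing mxE conjc_sum.
  under [RHS]eq_bigr => r _.
    rewrite conjcM mxE [u _ _]mxE conjc_sum big_distrl /=.
    over.
  rewrite [RHS]exchange_big /=; apply: eq_bigr => x _.
  rewrite (bigD1 (a' x)) //= [X in _ + X]big1 ?addr0 => [|r rx]; last first.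
    by rewrite (negbTE rx) mul0r rmorph0 mul0r.
  rewrite eqxx mul1r conjcK mxE conjc_sum.
  under [in RHS]eq_bigr => r _.
    rewrite conjcM [v _ _]mxE conjc_sum big_distrr /=.
    over.
  rewrite exchange_big /= big_distrr /=; apply: eq_bigr => y _.
  rewrite (bigD1 (b' y)) //= [X in _ + X]big1 ?addr0 => [|r rx]; last first.
    by rewrite (negbTE rx) mul0r rmorph0 mulr0.
  rewrite eqxx mul1r conjcK mxE big_ord1 !mxE mulrA mulrAC.
  by rewrite -!mulrA; congr (_ * _); rewrite mulrC.
rewrite norm_conjc; apply: (le_trans (bilinear_bound _ _)).
rewrite !l2_unitary; try exact: unitary_tr.
rewrite (l2_conj_row (fun x => conjc (p (a x) 0)) a'I).
rewrite (l2_conj_row (fun x => conjc (q (b x) 0)) b'I) -!mulrA.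
apply: ler_wpM2l; first by rewrite ler0c.
under eq_bigr do rewrite norm_conjc.
under [X in _ * X]eq_bigr do rewrite norm_conjc.
by apply: ler_pM; first [exact: (sum_injective_le (F := fun r => `|p r 0| ^+ 2))
   | exact: (sum_injective_le (F := fun r => `|q r 0| ^+ 2))
   | by apply: sumr_ge0 => ? _; rewrite exprn_ge0
   | by move=> ?; rewrite exprn_ge0].
Qed.

Lemma phaseB (x : 'I_N) (c c' : C) :
  phase x c - phase x c' = (c - c') *: (delta_mx x 0 *m (delta_mx x 0 : 'cV_N)^T).
Proof.
apply/matrixP => r s; rewrite !mxE big_ord1 !mxE !andbT.
have [<-|rs] := eqVneq r s; last first.
  rewrite !mulr0n subr0; have [rx|_] := eqVneq r x; last by rewrite mul0r mulr0.
  by rewrite -rx eq_sym (negbTE rs) !mulr0.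
by rewrite !mulr1n; case: eqP => _; rewrite ?mulr1 // mulr0 mulr0 subrr.
Qed.

(** [Y A Y^T] is quadratic in [Y]: changing its two factors in turn leaves two terms, each
    containing the rank one difference of the phases. *)
Lemma conj_tr_phaseB (K K' : 'M[C]_N) (x : 'I_N) (c c' : C)
  (e := delta_mx x 0 : 'cV[C]_N) (p := K *m e)
  (q := ((K'^T *m e)^T *m A *m (K *m phase x c *m K')^T)^T)
  (r := K *m phase x c' *m K' *m (A *m (K'^T *m e))) :
  conj_tr (K *m phase x c *m K') - conj_tr (K *m phase x c' *m K') =
  (c - c') *: (p *m q^T + r *m p^T).
Proof.
have trD z : (phase x z)^T = phase x z by rewrite tr_diag_mx.
rewrite /conj_tr /q /r /p trmxK !trmx_mul !trmxK !trD !mulmxA.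
set D := phase x c; set D' := phase x c'.
transitivity (K *m (D - D') *m K' *m A *m K'^T *m D *m K^T +
   K *m D' *m K' *m A *m K'^T *m (D - D') *m K^T).
  rewrite !mulmxBr !mulmxBl addrA; congr (_ - _).
  by rewrite subrK.
by rewrite phaseB -/e scalerDr -!scalemxAr -!scalemxAl !mulmxA.
Qed.

Definition entry (a a' b b' : 'I_n -> 'I_N) (Y : 'M[C]_N) : C :=
  pairing a a' b b' (conj_tr Y) (conj_tr Y).

Lemma pairingBl a a' b b' B1 B2 B3 :
  pairing a a' b b' (B1 - B2) B3 = pairing a a' b b' B1 B3 - pairing a a' b b' B2 B3.
Proof.
rewrite /pairing -sumrB; apply: eq_bigr => x _; rewrite -sumrB.
by apply: eq_bigr => y _; rewrite !mxE mulrBl.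
Qed.

Lemma pairingDl a a' b b' B1 B2 B3 :
  pairing a a' b b' (B1 + B2) B3 = pairing a a' b b' B1 B3 + pairing a a' b b' B2 B3.
Proof.
rewrite /pairing -big_split; apply: eq_bigr => x _; rewrite -big_split.
by apply: eq_bigr => y _; rewrite !mxE mulrDl.
Qed.

Lemma pairingZl a a' b b' z B1 B3 :
  pairing a a' b b' (z *: B1) B3 = z * pairing a a' b b' B1 B3.
Proof.
rewrite /pairing mulr_sumr; apply: eq_bigr => x _; rewrite mulr_sumr.
by apply: eq_bigr => y _; rewrite !mxE mulrA.
Qed.

Lemma pairing_rank1_le a a' b b' (p q : 'cV[C]_N) (Y : 'M[C]_N) :
  injective a -> injective a' -> injective b -> injective b' -> unitary Y ->
  l2 p * l2 q <= kappa%:C%C ->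
  `|pairing a a' b b' (p *m q^T) (conj_tr Y)| <= kappa%:C%C.
Proof.
move=> aI a'I bI b'I uY pq.
have k0 : 0 <= kappa%:C%C by rewrite ler0c.
rewrite -(@ler_pXn2r _ 2) ?nnegrE //.
apply: (le_trans (pairing_rank1 p q aI a'I bI b'I uY)).
by rewrite -mulrA expr2 ler_wpM2l.
Qed.

Lemma pairing_phaseB a a' b b' (K K' Y : 'M[C]_N) x c c' :
  injective a -> injective a' -> injective b -> injective b' ->
  unitary K -> unitary K' -> unitary Y -> c \in fourth_roots -> c' \in fourth_roots ->
  `|pairing a a' b b' (conj_tr (K *m phase x c *m K') -
      conj_tr (K *m phase x c' *m K')) (conj_tr Y)| <= 4 * kappa%:C%C.
Proof.
move=> aI a'I bI b'I uK uK' uY cr c'r.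
have uD z : z \in fourth_roots -> unitary (K *m phase x z *m K').
  by move=> zr; apply: unitaryM => //; apply: unitaryM => //; exact: unitary_phase.
have norm1 z : z \in fourth_roots -> `|z| = 1.
  move=> /fourth_root_norm zz; apply/eqP.
  by rewrite -(@eqrXn2 _ 2) // expr1n sqr_normc zz.
rewrite conj_tr_phaseB pairingZl pairingDl normrM.
have k0 : 0 <= kappa%:C%C by rewrite ler0c.
(* The factor 2 bounds [|c - c'|]; each of the two rank one terms contributes [kappa]. *)
have -> : 4 * kappa%:C%C = 2 * (kappa%:C%C + kappa%:C%C) :> C by ring.
apply: ler_pM => //.
  rewrite (le_trans (ler_normB _ _)) // !norm1 //.
have l2w : l2 (K'^T *m (delta_mx x 0 : 'cV[C]_N)) = 1.
  by rewrite l2_unitary ?l2_delta //; exact: unitary_tr.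
have l2p : l2 (K *m (delta_mx x 0 : 'cV[C]_N)) = 1.
  by rewrite l2_unitary ?l2_delta.
apply: (le_trans (ler_normD _ _)); apply: lerD; apply: pairing_rank1_le => //.
  rewrite l2p mul1r trmx_mul trmxK l2_unitary; last exact: uD.
  by have := l2_tr_bound (K'^T *m delta_mx x 0); rewrite l2w mulr1.
rewrite l2p mulr1 l2_unitary; last exact: uD.
by have := opA (K'^T *m delta_mx x 0); rewrite l2w mulr1.
Qed.

Lemma entry_phase_diff a a' b b' (K K' : 'M[C]_N) x c c' :
  injective a -> injective a' -> injective b -> injective b' ->
  unitary K -> unitary K' -> c \in fourth_roots -> c' \in fourth_roots ->
  `|entry a a' b b' (K *m phase x c *m K') -
    entry a a' b b' (K *m phase x c' *m K')| <= (8 * kappa)%:C%C.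
Proof.
move=> aI a'I bI b'I uK uK' cr c'r.
have uD z : z \in fourth_roots -> unitary (K *m phase x z *m K').
  by move=> zr; apply: unitaryM => //; apply: unitaryM => //; exact: unitary_phase.
set Y := K *m phase x c *m K'; set Y' := K *m phase x c' *m K'.
(* The two arguments of the pairing are changed in turn, and conjugate symmetry brings the second
   change to the left. Hence [4 kappa] twice. *)
have -> : entry a a' b b' Y - entry a a' b b' Y' =
    pairing a a' b b' (conj_tr Y - conj_tr Y') (conj_tr Y) +
    conjc (pairing a' a b' b (conj_tr Y - conj_tr Y') (conj_tr Y')).
  rewrite !pairingBl rmorphB /= -!pairingC /entry addrA; congr (_ - _).
  by rewrite subrK.
apply: (le_trans (ler_normD _ _)); rewrite norm_conjc.
have -> : (8 * kappa)%:C%C = 4 * kappa%:C%C + 4 * kappa%:C%C :> C.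
  by rewrite -mulrDl rmorphM /= -natrD rmorph_nat.
by apply: lerD; apply: pairing_phaseB => //; exact: uD.
Qed.

Lemma entry_bounded_difference a a' b b' (h : C -> R) (l : seq 'M[C]_N) :
  injective a -> injective a' -> injective b -> injective b' ->
  (forall z w, `|h z - h w|%:C%C <= `|z - w|) ->
  l \in phase_families -> bounded_difference (8 * kappa) l (h \o entry a a' b b').
Proof.
move=> aI a'I bI b'I hL /mapP[x _ ->] K K' uK uK' M M' /mapP[c cr ->] /mapP[c' c'r ->].
rewrite -lecR /=; apply: (le_trans (hL _ _)); exact: entry_phase_diff.
Qed.

End BoundedDifference.

(** * Averages over random phases *)

Section PhaseAverage.
Context {R : realType} {N : nat}.
Local Notation C := R[i].
Variable A : 'M[C]_N.
Local Notation B := (conj_tr A).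

Definition quad (q : ('I_N * 'I_N) * ('I_N * 'I_N)) (Y : 'M[C]_N) : C :=
  B Y q.1.1 q.1.2 * conjc (B Y q.2.1 q.2.2).

Lemma conj_trM (W Y : 'M[C]_N) : B (W *m Y) = W *m B Y *m W^T.
Proof. by rewrite /conj_tr trmx_mul !mulmxA. Qed.

Lemma conj_tr_phase z c (Y : 'M[C]_N) x y :
  B (phase z c *m Y) x y =
  (if x == z then c else 1) * (if y == z then c else 1) * B Y x y.
Proof.
rewrite conj_trM {1}/phase mul_diag_mx tr_diag_mx /phase mul_mx_diag !mxE.
by rewrite mulrAC.
Qed.

Lemma fourth_roots_moment (b1 b2 b3 b4 : bool) :
  \sum_(c <- fourth_roots) (if b1 then c else 1) * (if b2 then c else 1) *
    (conjc (if b3 then c else 1) * conjc (if b4 then c else 1)) =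
  4 * (b1 + b2 == b3 + b4)%N%:R :> C.
Proof.
rewrite /fourth_roots !big_cons big_nil.
case: b1; case: b2; case: b3; case: b4; apply/eqP; rewrite eq_complex;
  apply/andP; split; apply/eqP => /=; ring.
Qed.

Lemma avg_phase_quad z x y x' y' (Y : 'M[C]_N) :
  avg (phase_family z) (quad ((x, y), (x', y'))) Y =
  ((x == z) + (y == z) == (x' == z) + (y' == z))%N%:R * quad ((x, y), (x', y')) Y.
Proof.
rewrite /avg /phase_family big_map size_map [size _]/=.
under eq_bigr => c _.
  rewrite /quad /= !conj_tr_phase !conjcM mulrACA.
  over.
rewrite -mulr_suml fourth_roots_moment /quad /=.
by set m := (_ == _)%N%:R; field.
Qed.

Definition matched (q : ('I_N * 'I_N) * ('I_N * 'I_N)) : bool :=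
  (q.2 == q.1) || (q.2 == (q.1.2, q.1.1)).

(** A product survives all phases when [{x, y}] and [{x', y'}] agree as multisets; the
    multiplicities at these four points already decide it. *)
Lemma matchedP x y x' y' :
  [forall z, (x == z) + (y == z) == (x' == z) + (y' == z)]%N = matched ((x, y), (x', y')).
Proof.
rewrite /matched /= !xpair_eqE; apply/forallP/idP => [h|].
  have := h x; have := h y; have := h x'; have := h y'; rewrite !eqxx.
  rewrite (eq_sym y' x') (eq_sym x x') (eq_sym x y') (eq_sym y x') (eq_sym y y') (eq_sym y x).
  by case: (x' == x); case: (y' == y); case: (x' == y); case: (y' == x);
     case: (x' == y'); case: (x == y).
by case/orP => /andP[/eqP -> /eqP ->] z //; rewrite addnC.
Qed.

Lemma avgs_phase_quad q (Y : 'M[C]_N) :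
  avgs phase_families (quad q) Y = (matched q)%:R * quad q Y.
Proof.
case: q => [[x y] [x' y']]; rewrite -matchedP.
pose P z := ((x == z) + (y == z) == (x' == z) + (y' == z))%N.
have -> : [forall z, P z] = all P (enum 'I_N).
  by apply/forallP/allP => [h z _|h z]; [exact: h | apply: h; rewrite mem_enum].
rewrite /phase_families; elim: (enum _) => [|z s IH] /=; first by rewrite mul1r.
have -> : avg (phase_family z) (quad (x, y, (x', y'))) =
    fun Y => (P z)%:R * quad (x, y, (x', y')) Y.
  by apply/funext => W; rewrite avg_phase_quad.
by rewrite avgsZ IH mulrA -natrM mulnb.
Qed.

(** On the diagonal the two matchings coincide, so the swap sum leaves it out to avoid counting it
    twice. *)
Lemma sum_matched (F : ('I_N * 'I_N) * ('I_N * 'I_N) -> C) :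
  \sum_q (matched q)%:R * F q =
  \sum_p F (p, p) + \sum_(p | p.1 != p.2) F (p, (p.2, p.1)).
Proof.
rewrite [X in _ = _ + X]big_mkcond -big_split /=.
rewrite (eq_bigr (fun q => (matched (q.1, q.2))%:R * F (q.1, q.2))); last by case.
rewrite -(pair_bigA _ (fun p p' => (matched (p, p'))%:R * F (p, p'))) /=.
apply: eq_bigr => -[x y] _ /=.
rewrite (bigD1 (x, y)) //= {1}/matched eqxx mul1r; congr (_ + _).
have [<-|xy] := eqVneq x y => /=.
  by rewrite big1 // => p px; rewrite /matched /= orbb (negbTE px) mul0r.
rewrite (bigD1 (y, x)) /=; last by rewrite xpair_eqE eq_sym (negbTE xy).
rewrite {1}/matched /= eqxx orbT mul1r big1 ?addr0 // => p /andP[p1 p2].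
by rewrite /matched /= (negbTE p1) (negbTE p2) mul0r.
Qed.

Lemma avgs_phase_sum (c : ('I_N * 'I_N) * ('I_N * 'I_N) -> C) (Y : 'M[C]_N) :
  avgs phase_families (fun Y => \sum_q c q * quad q Y) Y =
  \sum_p c (p, p) * quad (p, p) Y +
  \sum_(p | p.1 != p.2) c (p, (p.2, p.1)) * quad (p, (p.2, p.1)) Y.
Proof.
rewrite avgs_sum -(sum_matched (fun q => c q * quad q Y)).
by apply: eq_bigr => q _; rewrite avgs_phase_quad mulrCA.
Qed.

End PhaseAverage.

(** * Mean of an entry over both layers of phases *)

Section Bias.
Context {R : realType} {n N : nat}.
Local Notation C := R[i].
Variables (A G : 'M[C]_N).
Local Notation B := (conj_tr A).
Hypothesis trA : \tr (A *m adjm A) = 1.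
Hypothesis unitaryG : unitary G.
Hypothesis flatG : forall x y, `|G x y| ^+ 2 = N%:R^-1.

Lemma frobenius (M : 'M[C]_N) : \tr (M *m adjm M) = \sum_p `|M p.1 p.2| ^+ 2.
Proof.
rewrite -(pair_bigA _ (fun x y => `|M x y| ^+ 2)) /=; apply: eq_bigr => x _.
by rewrite !mxE; apply: eq_bigr => y _; rewrite !mxE sqr_normc.
Qed.

Lemma frobenius_conj_tr (Y : 'M[C]_N) : unitary Y -> \sum_p `|B Y p.1 p.2| ^+ 2 = 1.
Proof.
move=> uY; rewrite -frobenius.
have uT : Y^T *m adjm Y^T = 1%:M by exact: unitary_tr.
have -> : B Y *m adjm (B Y) = Y *m (A *m adjm A) *m adjm Y.
  by rewrite /conj_tr !adjmM !mulmxA -(mulmxA _ Y^T) uT mulmx1.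
by rewrite mxtrace_mulC (mulmxA (adjm Y) Y) unitary_adj // mul1mx.
Qed.

Lemma norm4 x y x' y' u v u' v' :
  `|G x u * G y v * (conjc (G x' u') * conjc (G y' v'))| = (N%:R^-1) ^+ 2.
Proof.
have ge0 : 0 <= N%:R^-1 :> C by rewrite invr_ge0.
apply/eqP; rewrite -(@eqrXn2 _ 2) // ?exprn_ge0 // !normrM !exprMn !norm_conjc !flatG.
by set m := _^-1; apply/eqP; ring.
Qed.

Lemma quadM x y x' y' (Y : 'M[C]_N) : quad A ((x, y), (x', y')) (G *m Y) =
  \sum_q (G x q.1.1 * G y q.1.2 * (conjc (G x' q.2.1) * conjc (G y' q.2.2))) * quad A q Y.
Proof.
have E z w : B (G *m Y) z w = \sum_p G z p.1 * G w p.2 * B Y p.1 p.2.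
  rewrite conj_trM -(pair_bigA _ (fun u v => G z u * G w v * B Y u v)) /=.
  rewrite mxE exchange_big /=; apply: eq_bigr => v _.
  by rewrite !mxE mulr_suml; apply: eq_bigr => u _; rewrite mulrAC.
rewrite /quad /= !E conjc_sum big_distrlr /= -(pair_bigA _ (fun p p' =>
  (G x p.1 * G y p.2 * (conjc (G x' p'.1) * conjc (G y' p'.2))) *
    (B Y p.1 p.2 * conjc (B Y p'.1 p'.2)))) /=.
by apply: eq_bigr => p _; apply: eq_bigr => p' _; rewrite !conjcM mulrACA.
Qed.

Lemma avg1 {K : numFieldType} (g : 'M[C]_N -> K) : avg [:: G] g = fun Y => g (G *m Y).
Proof. by apply/funext => Y; rewrite /avg big_seq1 divr1. Qed.

Lemma norm_quad_swap_sum (Y : 'M[C]_N) : unitary Y ->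
  \sum_(p | p.1 != p.2) `|quad A (p, (p.2, p.1)) Y| <= 1.
Proof.
move=> uY.
have swapK : cancel (fun p : 'I_N * 'I_N => (p.2, p.1)) (fun p => (p.2, p.1)) by case.
have S : \sum_p (2^-1 * `|B Y p.1 p.2| ^+ 2 + 2^-1 * `|B Y p.2 p.1| ^+ 2) = 1 :> C.
  rewrite big_split -!mulr_sumr /= frobenius_conj_tr // mulr1.
  rewrite (reindex_inj (can_inj swapK)) /= frobenius_conj_tr // mulr1.
  by field.
rewrite -S big_mkcond; apply: ler_sum => p _.
have r0 : 0 <= (`|B Y p.1 p.2| - `|B Y p.2 p.1|) ^+ 2.
  by apply: real_exprn_even_ge0 => //; rewrite realB // normr_real.
have r1 : `|quad A (p, (p.2, p.1)) Y| <=
    2^-1 * `|B Y p.1 p.2| ^+ 2 + 2^-1 * `|B Y p.2 p.1| ^+ 2.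
  rewrite /quad /= normrM norm_conjc -subr_ge0 -(@pmulr_rge0 _ 2) //.
  by move: r0; congr (0 <= _); field.
by case: (p.1 != p.2) => //; exact: (le_trans (normr_ge0 _) r1).
Qed.

(** After expansion through [G] all coefficients have modulus [N^-2]. The unswapped products have
    total modulus 1, by the Frobenius normalisation, and the swapped ones at most 1, whence the
    factor 2. *)
Lemma avgs_quad_flat x y x' y' (Y : 'M[C]_N) : unitary Y ->
  `|avgs ([:: G] :: phase_families) (quad A ((x, y), (x', y'))) Y| <= 2 * (N%:R^-1) ^+ 2.
Proof.
move=> uY; rewrite /= avg1.
under [X in avgs _ X]funext => W do rewrite quadM.
rewrite avgs_phase_sum (le_trans (ler_normD _ _)) // mulr_natl mulr2n; apply: lerD.
  apply: (le_trans (ler_norm_sum _ _ _)).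
  under eq_bigr do rewrite normrM norm4.
  rewrite -mulr_sumr ler_piMr ?exprn_ge0 ?invr_ge0 //.
  rewrite -(frobenius_conj_tr uY); apply: ler_sum => p _.
  by rewrite /quad /= normrM norm_conjc.
apply: (le_trans (ler_norm_sum _ _ _)).
under eq_bigr do rewrite normrM norm4.
by rewrite -mulr_sumr ler_piMr ?exprn_ge0 ?invr_ge0 // norm_quad_swap_sum.
Qed.

(** For row blocks, the value at [x = y] is an entry of the reduced state on [C^k] of column [x] of
    [G]. *)
Definition gram (a a' : 'I_n -> 'I_N) (x y : 'I_N) : C :=
  \sum_u G (a u) x * conjc (G (a' u) y).

Lemma unitary_row x y : \sum_z G x z * conjc (G y z) = (x == y)%:R.
Proof.
have := congr1 (fun M : 'M[C]_N => M x y) unitaryG; rewrite !mxE => <-.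
by apply: eq_bigr => z _; rewrite !mxE.
Qed.

(** Summing over the columns first turns the squares into products of inner products of rows of [G];
    orthonormality leaves the [n] terms with [u = w]. *)
Lemma gram_sum a a' : injective a -> injective a' ->
  \sum_x \sum_y `|gram a a' x y| ^+ 2 = n%:R.
Proof.
move=> aI a'I.
transitivity (\sum_u \sum_w (\sum_x G (a u) x * conjc (G (a w) x)) *
   (\sum_y G (a' w) y * conjc (G (a' u) y))).
  under eq_bigr => x _.
    under eq_bigr => y _.
      rewrite sqr_normc /gram conjc_sum big_distrlr /=.
      over.
    rewrite exchange_big /=.
    under eq_bigr => u _ do rewrite exchange_big /=.
    over.
  rewrite exchange_big /=; apply: eq_bigr => u _.
  rewrite exchange_big /=; apply: eq_bigr => w _.
  rewrite big_distrlr /=; apply: eq_bigr => x _; apply: eq_bigr => y _.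
  by rewrite conjcM conjcK; ring.
under eq_bigr => u _.
  rewrite (bigD1 u) //= [X in _ + X]big1 ?addr0 => [|w wu]; last first.
    by rewrite !unitary_row (inj_eq aI) eq_sym (negbTE wu) mul0r.
  rewrite !unitary_row !eqxx mulr1.
  over.
by rewrite sumr_const card_ord.
Qed.

Lemma entryM a a' b b' (Y : 'M[C]_N) : entry A a a' b b' (G *m Y) =
  \sum_q (gram a a' q.1.1 q.2.1 * gram b b' q.1.2 q.2.2) * quad A q Y.
Proof.
rewrite /entry /pairing.
under eq_bigr => u _.
  under eq_bigr => v _.
    rewrite -[_ * _]/(quad A ((a u, b v), (a' u, b' v)) (G *m Y)) quadM.
    over.
  rewrite exchange_big /=.
  over.
rewrite exchange_big /=; apply: eq_bigr => q _.
rewrite /gram big_distrlr mulr_suml; apply: eq_bigr => u _.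
by rewrite mulr_suml; apply: eq_bigr => v _ /=; congr (_ * _); ring.
Qed.

(** Encodes [G D G D'], with one family for each diagonal coefficient so that the moment bounds
    change a single coefficient at a time. *)
Definition mixing : seq (seq 'M[C]_N) :=
  ([:: G] :: phase_families) ++ ([:: G] :: phase_families).

Lemma unitary_mixing : unitary_families mixing.
Proof.
have h : unitary_families ([:: G] :: phase_families).
  move=> l; rewrite inE => /orP[/eqP ->|]; first exact: unitary_family1.
  exact: unitary_phase_families.
exact: unitary_families_cat.
Qed.

Lemma size_mixing : size mixing = (2 * N.+1)%N.
Proof. by rewrite size_cat /= size_map size_enum_ord mul2n addnn. Qed.

Lemma avgs_entry_bias a a' b b' (alpha beta : C) (Y : 'M[C]_N) :
  injective a -> injective a' -> injective b -> injective b' -> unitary Y ->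
  (forall x, gram a a' x x = alpha) -> (forall x, gram b b' x x = beta) ->
  `|avgs mixing (entry A a a' b b') Y - alpha * beta| <= 2 * n%:R * (N%:R^-1) ^+ 2.
Proof.
move=> aI a'I bI b'I uY ga gb.
pose c (p : 'I_N * 'I_N) := gram a a' p.1 p.2 * gram b b' p.2 p.1.
pose F (Y : 'M[C]_N) := \sum_(p | p.1 != p.2) c p * quad A (p, (p.2, p.1)) Y.
have uGP : unitary_families ([:: G] :: @phase_families R N).
  move=> l; rewrite inE => /orP[/eqP ->|]; first exact: unitary_family1.
  exact: unitary_phase_families.
(* The unswapped part is exact: all its coefficients equal [alpha * beta] and the squared moduli of
   [B] sum to 1. The whole bias is in the swap sum [F]. *)
have first_layer W : unitary W ->
    avgs ([:: G] :: phase_families) (entry A a a' b b') W = alpha * beta + F W.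
  move=> uW /=; rewrite avg1.
  under [X in avgs _ X]funext => V do rewrite entryM.
  rewrite avgs_phase_sum; congr (_ + _).
  under eq_bigr do rewrite /= ga gb.
  rewrite -mulr_sumr -[RHS]mulr1 -(frobenius_conj_tr uW); congr (_ * _).
  by apply: eq_bigr => p _; rewrite /quad sqr_normc.
rewrite /mixing avgs_cat (avgs_ext uGP uY first_layer).
rewrite avgsD avgs_cst // addrC addKr /F avgs_sum.
(* By AM-GM and [gram_sum], the swap coefficients have total modulus at most [n]; with at most
   [2 / N^2] for each averaged product this leaves [2 n / N^2]. *)
have c_sum : \sum_(p | p.1 != p.2) `|c p| <= n%:R :> C.
  have swapK : cancel (fun p : 'I_N * 'I_N => (p.2, p.1)) (fun p => (p.2, p.1)) by case.
  have S : \sum_p (2^-1 * `|gram a a' p.1 p.2| ^+ 2 +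
      2^-1 * `|gram b b' p.2 p.1| ^+ 2) = n%:R :> C.
    rewrite big_split -!mulr_sumr /=.
    rewrite [X in _ + _ * X](reindex_inj (can_inj swapK)) /=.
    rewrite -(pair_bigA _ (fun x y => `|gram a a' x y| ^+ 2)) gram_sum //=.
    rewrite -(pair_bigA _ (fun x y => `|gram b b' x y| ^+ 2)) gram_sum //=.
    by field.
  rewrite -S big_mkcond; apply: ler_sum => p _.
  have r0 : 0 <= (`|gram a a' p.1 p.2| - `|gram b b' p.2 p.1|) ^+ 2.
    by apply: real_exprn_even_ge0 => //; rewrite realB // normr_real.
  have r1 : `|c p| <=
      2^-1 * `|gram a a' p.1 p.2| ^+ 2 + 2^-1 * `|gram b b' p.2 p.1| ^+ 2.
    rewrite /c normrM -subr_ge0 -(@pmulr_rge0 _ 2) //.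
    by move: r0; congr (0 <= _); field.
  by case: (p.1 != p.2) => //; exact: (le_trans (normr_ge0 _) r1).
apply: (le_trans (ler_norm_sum _ _ _)).
have -> : 2 * n%:R * N%:R^-1 ^+ 2 = n%:R * (2 * N%:R^-1 ^+ 2) :> C by ring.
have K0 : 0 <= 2 * N%:R^-1 ^+ 2 :> C by rewrite mulr_ge0 // exprn_ge0 // invr_ge0.
apply: le_trans (ler_wpM2r K0 c_sum); rewrite mulr_suml.
apply: ler_sum => p _; rewrite normrM ler_wpM2l //.
by case: p => x y; exact: avgs_quad_flat.
Qed.

End Bias.

(** * A flat unitary matrix with maximally entangled columns *)

Section Fourier.
Context {R : realType}.
Local Notation C := R[i].

(** [X^m - 1] splits over the algebraically closed field [C] and is separable in characteristic 0,
    so it has [m] distinct roots, among which one is primitive. *)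
Lemma prim_root_exists m : (0 < m)%N -> exists w : C, m.-primitive_root w.
Proof.
pose p : {poly C} := 'X^m - 1; have [r Dp] := closed_field_poly_normal p.
move=> m0; rewrite (monicP _) ?monicXnsubC // scale1r in Dp.
have rm1 : all m.-unity_root r by apply/allP=> z; rewrite -root_prod_XsubC -Dp.
have sz_r : (m < (size r).+1)%N.
  by rewrite -(size_prod_XsubC r id) -Dp size_XnsubC.
have [|z] := hasP (has_prim_root m0 rm1 _ sz_r); last by exists z.
by rewrite -separable_prod_XsubC -Dp separable_Xn_sub_1 // pnatr_eq0 -lt0n.
Qed.

Lemma prim_root_norm m (w : C) i : m.-primitive_root w -> w ^+ i * conjc (w ^+ i) = 1.
Proof.
move=> wP; have m0 := prim_order_gt0 wP.
have w1 : `|w| = 1.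
  by apply/eqP; rewrite -(@pexpr_eq1 _ _ m) // -normrX (prim_expr_order wP) normr1.
by rewrite -sqr_normc normrX w1 !expr1n.
Qed.

Lemma prim_root_sum m (w : C) i j : m.-primitive_root w ->
  \sum_(a < m) (w ^+ i * conjc (w ^+ j)) ^+ a = (i == j %[mod m])%:R * m%:R.
Proof.
move=> wP; rewrite -(eq_prim_root_expr wP).
have [->|ij] := eqVneq (w ^+ i) (w ^+ j).
  under eq_bigr do rewrite (prim_root_norm _ wP) expr1n.
  by rewrite sumr_const card_ord mul1r.
have z1 : w ^+ i * conjc (w ^+ j) - 1 != 0.
  apply: contra ij; rewrite subr_eq0 => /eqP e.
  rewrite -[w ^+ i]mulr1 -(prim_root_norm j wP) mulrCA e mulr1 //.
rewrite mul0r; apply: (mulfI z1); rewrite mulr0 -subrX1.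
have e u : (w ^+ u) ^+ m = 1 by rewrite exprAC (prim_expr_order wP) expr1n.
by rewrite exprMn -rmorphXn /= !e conjc1 mulr1 subrr.
Qed.

Context {k n : nat}.
Hypotheses (k0 : (0 < k)%N) (kn : (k <= n)%N).
Variables (wk wn : C).
Hypotheses (wkP : k.-primitive_root wk) (wnP : n.-primitive_root wn).

Definition row_block (i : 'I_k) (b : 'I_n) : 'I_(k * n) := mxtens_index (i, b).

Lemma row_block_inj i : injective (row_block i).
Proof. by move=> b c /(can_inj (@mxtens_indexK k n)) []. Qed.

Definition fourier_scale : C := ((Num.sqrt (k * n)%:R)^-1 : R)%:C%C.

(* The columns of this tensor product of Fourier matrices, with row [(i, b)] multiplied
   by [wn ^ (i b)], are maximally entangled vectors of [C^k (x) C^n] as soon as [k <= n]. *)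
Definition entangled_fourier : 'M[C]_(k * n) :=
  \matrix_(p, x) (fourier_scale *
    (wk ^+ ((mxtens_unindex x).1 * (mxtens_unindex p).1) *
     wn ^+ (((mxtens_unindex x).2 + (mxtens_unindex p).1) * (mxtens_unindex p).2))).
Local Notation G := entangled_fourier.

Lemma fourier_scale_sqr : fourier_scale * conjc fourier_scale = (k * n)%:R^-1.
Proof.
rewrite conjc_real -rmorphM /= -invrM ?unitfE ?sqrtr_eq0 -?ltNge; last 2 first.
- by rewrite ltr0n muln_gt0 k0 (leq_trans k0 kn).
- by rewrite ltr0n muln_gt0 k0 (leq_trans k0 kn).
by rewrite -expr2 sqr_sqrtr // fmorphV /= rmorph_nat.
Qed.

Lemma entangled_fourierE i b (a : 'I_k) (c : 'I_n) :
  G (row_block i b) (mxtens_index (a, c)) =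
  fourier_scale * (wk ^+ (a * i) * wn ^+ ((c + i) * b)).
Proof. by rewrite mxE !mxtens_indexK. Qed.

Lemma entangled_fourier_flat x y : `|G x y| ^+ 2 = (k * n)%:R^-1.
Proof.
case: (mxtens_indexP x) => i b; case: (mxtens_indexP y) => a c.
rewrite entangled_fourierE sqr_normc !conjcM mulrACA fourier_scale_sqr.
by rewrite mulrACA (prim_root_norm _ wkP) (prim_root_norm _ wnP) !mulr1.
Qed.

Lemma sum_mxtens (F : 'I_(k * n) -> C) :
  \sum_x F x = \sum_a \sum_c F (mxtens_index (a, c)).
Proof.
rewrite pair_bigA /= (reindex (@mxtens_index k n)); last first.
  by exists (@mxtens_unindex k n) => ? _; rewrite ?mxtens_indexK ?mxtens_unindexK.
by apply: eq_bigr => -[].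
Qed.

Lemma unitary_entangled_fourier : unitary G.
Proof.
have n0 : (0 < n)%N by exact: leq_trans kn.
apply/matrixP => x y; rewrite !mxE.
case: (mxtens_indexP x) => i b; case: (mxtens_indexP y) => j d.
transitivity ((k * n)%:R^-1 * (\sum_(a < k) (wk ^+ i * conjc (wk ^+ j)) ^+ a) *
   (\sum_(c < n) (wn ^+ b * conjc (wn ^+ d)) ^+ c) *
   (wn ^+ (i * b) * conjc (wn ^+ (j * d)))).
  rewrite [_^-1 * \sum_(a < k) _]mulr_sumr 2!mulr_suml sum_mxtens; apply: eq_bigr => a _.
  rewrite [in RHS]mulr_sumr mulr_suml; apply: eq_bigr => c _.
  rewrite [adjm _ _ _]mxE [map_mx _ _ _ _]mxE -/(row_block i b) -/(row_block j d).
  rewrite !entangled_fourierE !conjcM -fourier_scale_sqr !exprMn -!rmorphXn /= -!exprM.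
  by rewrite !mulnDl !exprD !rmorphM /= ![(a * _)%N]mulnC ![(c * _)%N]mulnC; ring.
rewrite !prim_root_sum // !modn_small ?ltn_ord //.
rewrite -[nat_of_ord i == j]/(i == j) -[nat_of_ord b == d]/(b == d).
rewrite (can_eq (@mxtens_indexK k n)) xpair_eqE.
have [<-|] := eqVneq i j; last by rewrite !mul0r mulr0 !mul0r.
have [<-|] := eqVneq b d; last by rewrite !mul0r mulr0 !mul0r.
rewrite (prim_root_norm _ wnP) !mul1r mulr1 natrM -mulrA mulVf //.
by rewrite -natrM pnatr_eq0 muln_eq0 negb_or -!lt0n k0.
Qed.

(** The twist by [i b] shifts the frequency in [C^n]: the blocks [i] and [j] of one column have
    frequencies [c + i] and [c + j], orthogonal unless [i] and [j] agree modulo [n]. The hypothesis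
    [k <= n] turns this congruence into equality. *)
Lemma gram_entangled_fourier i j x :
  gram G (row_block i) (row_block j) x x = (i == j)%:R / k%:R.
Proof.
have n0 : (0 < n)%N by exact: leq_trans kn.
case: (mxtens_indexP x) => a c; rewrite /gram.
transitivity ((k * n)%:R^-1 * (wk ^+ (a * i) * conjc (wk ^+ (a * j))) *
  \sum_(b < n) (wn ^+ (c + i) * conjc (wn ^+ (c + j))) ^+ b).
  rewrite mulr_sumr; apply: eq_bigr => b _.
  rewrite !entangled_fourierE !conjcM -fourier_scale_sqr exprMn -rmorphXn /= -!exprM.
  by ring.
rewrite prim_root_sum // eqn_modDl !modn_small; last 2 first.
- exact: leq_trans kn.
- exact: leq_trans kn.
rewrite -(inj_eq val_inj); have [->|_] := eqVneq (val i) (val j); last by rewrite !mul0r mulr0.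
rewrite (prim_root_norm _ wkP) mulr1 !mul1r natrM invfM -mulrA mulVf ?mulr1 //.
by rewrite pnatr_eq0 -lt0n.
Qed.

End Fourier.

(** * Channel output *)

Section OperatorNorm.
Context {R : realType}.
Local Notation C := R[i].

Lemma Re_ge0 (z : C) : 0 <= z -> 0 <= complex.Re z.
Proof. by case: z => a b; rewrite lecE => /andP[]. Qed.

Lemma ge0_ReK (z : C) : 0 <= z -> (complex.Re z)%:C%C = z.
Proof. by move=> z0; rewrite RRe_real // ger0_real. Qed.

Lemma l2_vnorm2 m (v : 'cV[C]_m) : l2 v = ((vnorm2 v) ^+ 2)%:C%C.
Proof.
rewrite /vnorm2 sqr_sqrtr; last first.
  by apply: sumr_ge0 => a _; apply: Re_ge0; exact: mulcJ_ge0.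
rewrite rmorph_sum /=; apply: eq_bigr => a _.
by rewrite ge0_ReK ?sqr_normc // mulcJ_ge0.
Qed.

Lemma vnorm2_ge0 m (v : 'cV[C]_m) : 0 <= vnorm2 v.
Proof. exact: sqrtr_ge0. Qed.

Lemma l2Z m (z : C) (v : 'cV[C]_m) : l2 (z *: v) = `|z| ^+ 2 * l2 v.
Proof. by rewrite /l2 mulr_sumr; apply: eq_bigr => a _; rewrite mxE normrM exprMn. Qed.

Lemma l2_mulmx_le m n (A : 'M[C]_(m, n)) v :
  l2 (A *m v) <= (\sum_i \sum_j `|A i j| ^+ 2) * l2 v.
Proof. by rewrite mulr_suml; apply: ler_sum => a _; rewrite mxE; exact: sumCS. Qed.

(** A real [sup] dominates the elements of its set only if that set is bounded above; the Frobenius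
    norm supplies such a bound. *)
Lemma vnorm2_le_opnorm m n (A : 'M[C]_(m, n)) v : vnorm2 v <= 1 ->
  vnorm2 (A *m v) <= opnorm A.
Proof.
move=> v1; apply: ub_le_sup; last by exists v.
pose F := \sum_i \sum_j `|A i j| ^+ 2.
have F0 : 0 <= F by apply: sumr_ge0 => a _; apply: sumr_ge0 => b _; rewrite exprn_ge0.
exists (Num.sqrt (complex.Re F)) => _ [u /= u1 <-].
rewrite -(@ler_pXn2r _ 2) ?nnegrE ?sqrtr_ge0 // (sqr_sqrtr (Re_ge0 F0)).
rewrite -lecR -l2_vnorm2 ge0_ReK //.
apply: (le_trans (l2_mulmx_le A u)); rewrite ler_piMr //.
by rewrite l2_vnorm2 -[1]/((1 : R)%:C%C) lecR expr_le1 // vnorm2_ge0.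
Qed.

Lemma l2_le_opnorm m n (A : 'M[C]_(m, n)) (c : R) v : opnorm A <= c ->
  l2 (A *m v) <= (c ^+ 2)%:C%C * l2 v.
Proof.
move=> Ac; have [v0|v0] := eqVneq (vnorm2 v) 0.
  have := l2_mulmx_le A v; rewrite [in leRHS]l2_vnorm2 v0 expr0n mulr0 => h.
  by rewrite [in leRHS]l2_vnorm2 v0 expr0n mulr0.
have vp : 0 < vnorm2 v by rewrite lt0r v0 vnorm2_ge0.
pose u := ((vnorm2 v)^-1)%:C%C *: v.
have norm_inv : `|((vnorm2 v)^-1)%:C%C| ^+ 2 = ((vnorm2 v)^-1 ^+ 2)%:C%C.
  by rewrite ger0_norm ?ler0c ?invr_ge0 ?vnorm2_ge0 // rmorphXn.
have u1 : vnorm2 u <= 1.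
  rewrite -(@ler_pXn2r _ 2) ?nnegrE ?vnorm2_ge0 // -lecR -l2_vnorm2 l2Z norm_inv.
  by rewrite l2_vnorm2 -rmorphM /= -exprMn mulVf.
have Au := le_trans (vnorm2_le_opnorm A u1) Ac.
have Au2 : l2 (A *m u) <= (c ^+ 2)%:C%C.
  by rewrite l2_vnorm2 lecR lerXn2r ?nnegrE ?vnorm2_ge0 // (le_trans _ Au) ?vnorm2_ge0.
have vE : v = (vnorm2 v)%:C%C *: u.
  by rewrite scalerA -rmorphM /= mulfV // scale1r.
have e : `|(vnorm2 v)%:C%C| ^+ 2 = l2 v.
  by rewrite l2_vnorm2 ger0_norm ?ler0c ?vnorm2_ge0 // rmorphXn.
by rewrite {1}vE -scalemxAr l2Z e mulrC ler_wpM2r // l2_ge0.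
Qed.

End OperatorNorm.

(** * Zero-padding to a square matrix *)

Section Padding.
Context {R : realType} {N d : nat}.
Local Notation C := R[i].
Hypothesis dN : (d <= N)%N.

Definition inclusion : 'M[C]_(N, d) := firstcols d (1%:M : 'M[C]_N).
Local Notation J := inclusion.

Lemma firstcolsE (M : 'M[C]_N) a j : firstcols d M a j = M a (widen_ord dN j).
Proof.
rewrite mxE; case: insubP => [j' _ ej|]; first by congr (M a _); exact: val_inj.
by rewrite (leq_trans (ltn_ord j) dN).
Qed.

Lemma firstcols_inclusion (M : 'M[C]_N) : firstcols d M = M *m J.
Proof.
apply/matrixP => a j; rewrite firstcolsE mxE (bigD1 (widen_ord dN j)) //= big1.
  by rewrite addr0 firstcolsE mxE eqxx mulr1.
by move=> b bj; rewrite firstcolsE mxE (negbTE bj) mulr0.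
Qed.

Lemma adjm_inclusion : adjm J = J^T.
Proof.
apply/matrixP => a b; rewrite /adjm [LHS]mxE [RHS]mxE [LHS]mxE.
by rewrite firstcolsE mxE conjc_nat.
Qed.

Lemma inclusion_isometry : J^T *m J = 1%:M.
Proof.
apply/matrixP => a b; rewrite !mxE (bigD1 (widen_ord dN a)) //= big1.
  by rewrite addr0 mxE !firstcolsE !mxE eqxx mul1r.
by move=> c ca; rewrite mxE firstcolsE mxE (negbTE ca) mul0r.
Qed.

(** Since [V = U J], one has [V A V^T = U (J A J^T) U^T]: the truncation to the first columns moves
    into the fixed matrix, and left multiplications act on the full unitary [U]. *)
Definition padding (A : 'M[C]_d) : 'M[C]_N := J *m A *m J^T.

Lemma padding_trace (A : 'M[C]_d) : \tr (A *m adjm A) = 1 ->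
  \tr (padding A *m adjm (padding A)) = 1.
Proof.
move=> <-; rewrite /padding !adjmM adjm_tr adjm_inclusion trmxK.
rewrite !mulmxA -(mulmxA _ J^T J) inclusion_isometry mulmx1 mxtrace_mulC.
by rewrite !mulmxA inclusion_isometry mul1mx.
Qed.

Lemma l2_inclusion v : l2 (J *m v) = l2 v.
Proof.
by rewrite !l2E adjmM adjm_inclusion -mulmxA (mulmxA J^T) inclusion_isometry mul1mx.
Qed.

Lemma l2_inclusion_tr (v : 'cV[C]_N) : l2 (J^T *m v) <= l2 v.
Proof.
have wI : injective (widen_ord dN) by move=> a b /(congr1 val) /= ab; exact: val_inj.
have F0 p : 0 <= `|v p 0| ^+ 2 by rewrite exprn_ge0.
apply: le_trans (sum_injective_le (F := fun p => `|v p 0| ^+ 2) wI F0).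
apply: ler_sum => a _; rewrite mxE (bigD1 (widen_ord dN a)) //= big1 => [|c ca].
  by rewrite addr0 mxE firstcolsE mxE eqxx mul1r.
by rewrite mxE firstcolsE mxE (negbTE ca) mul0r.
Qed.

Lemma padding_opnorm (A : 'M[C]_d) (c : R) v : opnorm A <= c ->
  l2 (padding A *m v) <= (c ^+ 2)%:C%C * l2 v.
Proof.
move=> Ac; rewrite /padding -!mulmxA l2_inclusion.
apply: (le_trans (l2_le_opnorm _ Ac)); rewrite ler_wpM2l ?ler0c ?sqr_ge0 //.
exact: l2_inclusion_tr.
Qed.

End Padding.

Section Output.
Context {R : realType} {k n d : nat}.
Local Notation C := R[i].
Hypothesis dN : (d <= k * n)%N.

(** Vectorisation turns [V (x) V] into a congruence. A transpose appears instead of an adjoint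
    because the second copy also applies [V], not its conjugate. *)
Lemma psi_vec_conj_tr N (V : 'M[C]_(N, d)) (A : 'M[C]_d) x y :
  ((V *t V) *m psi_vec A) (mxtens_index (x, y)) 0 = (V *m A *m V^T) x y.
Proof.
rewrite mxE sum_mxtens -mulmxA mxE; apply: eq_bigr => a _.
rewrite mxE mulr_sumr; apply: eq_bigr => c _.
by rewrite tensmxE !mxE mxtens_indexK /= -mulrA [V y c * _]mulrC.
Qed.

Lemma PhiC_tensE (U : 'M[C]_(k * n)) (A : 'M[C]_d) p q :
  PhiC_tens (firstcols d U) (psi_vec A *m adjm (psi_vec A)) p q =
  entry (padding A) (row_block (mxtens_unindex p).1) (row_block (mxtens_unindex q).1)
    (row_block (mxtens_unindex p).2) (row_block (mxtens_unindex q).2) U.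
Proof.
rewrite /PhiC_tens; set V := firstcols d U.
have -> : (V *t V) *m (psi_vec A *m adjm (psi_vec A)) *m adjm (V *t V) =
    (V *t V) *m psi_vec A *m adjm ((V *t V) *m psi_vec A).
  by rewrite adjmM !mulmxA.
rewrite mxE /entry /pairing; apply: eq_bigr => b _; apply: eq_bigr => b' _.
have E x y : ((V *t V) *m psi_vec A) (mxtens_index (x, y)) 0 = conj_tr (padding A) U x y.
  rewrite psi_vec_conj_tr /V firstcols_inclusion // /conj_tr /padding.
  by rewrite trmx_mul !mulmxA.
by rewrite mxE big_ord1 E [adjm _ _ _]mxE [map_mx _ _ _ _]mxE E.
Qed.

End Output.

(** * Haar-distributed matrices *)

Section FunctionAlgebra.
Context {R : realType}.
Local Notation C := R[i].

(** One closure argument then yields both measurability on [Omega] and continuity on matrices, as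
    the Haar hypothesis requires. The minimum is there for truncations. *)
Definition function_algebra (T : Type) (F : (T -> R) -> Prop) :=
  [/\ (forall c, F (fun=> c)), (forall f g, F f -> F g -> F (fun x => f x + g x)),
      (forall f g, F f -> F g -> F (fun x => f x * g x)) &
      (forall f c, F f -> F (fun x => Num.min (f x) c))].

Lemma measurable_algebra (d : measure_display) (T : measurableType d) :
  @function_algebra T (measurable_fun setT).
Proof.
split => [c|f g mf mg|f g mf mg|f c mf].
- exact: measurable_cst.
- exact: measurable_funD.
- exact: measurable_funM.
- by apply: measurable_minr => //; exact: measurable_cst.
Qed.

Lemma continuous_algebra (T : topologicalType) :
  @function_algebra T (fun f => continuous f).
Proof.
split => [c|f g cf cg|f g cf cg|f c cf] x.
- exact: cst_continuous.
- by apply: continuousD; [exact: cf | exact: cg].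
- by apply: continuousM; [exact: cf | exact: cg].
- by apply: continuous_min => //; [exact: cf | exact: cst_continuous].
Qed.

Definition complex_in (T : Type) (F : (T -> R) -> Prop) (h : T -> C) :=
  F (fun x => complex.Re (h x)) /\ F (fun x => complex.Im (h x)).

Section Closure.
Variables (T : Type) (F : (T -> R) -> Prop).
Hypothesis FA : function_algebra F.

Lemma algebraN f : F f -> F (fun x => - f x).
Proof.
case: FA => Fc _ FM _ Ff; rewrite (_ : (fun _ => _) = fun x => -1 * f x); first exact: FM.
by apply/funext => x; rewrite mulN1r.
Qed.

Lemma algebraX f m : F f -> F (fun x => f x ^+ m).
Proof.
case: FA => Fc _ FM _ Ff; elim: m => [|m IH]; first exact: Fc.
by under eq_fun do rewrite exprS; exact: FM.
Qed.

Lemma algebra_sum (I : Type) (r : seq I) (f : I -> T -> R) :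
  (forall j, F (f j)) -> F (fun x => \sum_(j <- r) f j x).
Proof.
case: FA => Fc FD _ _ Ff; elim: r => [|j r IH].
  by under eq_fun do rewrite big_nil; exact: Fc.
by under eq_fun do rewrite big_cons; exact: FD.
Qed.

Lemma complex_in_cst c : complex_in F (fun=> c).
Proof. by case: FA => Fc _ _ _; split; exact: Fc. Qed.

Lemma complex_inD f g : complex_in F f -> complex_in F g -> complex_in F (fun x => f x + g x).
Proof.
case: FA => _ FD _ _ [f1 f2] [g1 g2].
by split; under eq_fun do rewrite raddfD; exact: FD.
Qed.

Lemma complex_inM f g : complex_in F f -> complex_in F g -> complex_in F (fun x => f x * g x).
Proof.
case: FA => _ FD FM _ [f1 f2] [g1 g2]; split.
  rewrite (_ : (fun _ => _) = fun x => complex.Re (f x) * complex.Re (g x) +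
    - (complex.Im (f x) * complex.Im (g x))).
    by apply: FD; [exact: FM | apply: algebraN; exact: FM].
  by apply/funext => x; case: (f x) (g x) => [a b] [c e].
rewrite (_ : (fun _ => _) = fun x => complex.Re (f x) * complex.Im (g x) +
  complex.Im (f x) * complex.Re (g x)); first by apply: FD; exact: FM.
by apply/funext => x; case: (f x) (g x) => [a b] [c e].
Qed.

Lemma complex_in_conj f : complex_in F f -> complex_in F (fun x => conjc (f x)).
Proof.
case=> f1 f2; split.
  by rewrite (_ : (fun _ => _) = fun x => complex.Re (f x)) //; apply/funext => x; case: (f x).
rewrite (_ : (fun _ => _) = fun x => - complex.Im (f x)); first exact: algebraN.
by apply/funext => x; case: (f x).
Qed.

Lemma complex_in_sum (I : Type) (r : seq I) (f : I -> T -> C) :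
  (forall j, complex_in F (f j)) -> complex_in F (fun x => \sum_(j <- r) f j x).
Proof.
move=> Ff; elim: r => [|j r IH].
  by under eq_fun do rewrite big_nil; exact: complex_in_cst.
by under eq_fun do rewrite big_cons; exact: complex_inD.
Qed.

Definition matrix_in m n (W : T -> 'M[C]_(m, n)) := forall a b, complex_in F (fun x => W x a b).

Lemma matrix_in_cst m n (M : 'M[C]_(m, n)) : matrix_in (fun=> M).
Proof. by move=> a b; exact: complex_in_cst. Qed.

Lemma matrix_inM m n p (V : T -> 'M[C]_(m, n)) (W : T -> 'M[C]_(n, p)) :
  matrix_in V -> matrix_in W -> matrix_in (fun x => V x *m W x).
Proof.
move=> FV FW a b; under [X in complex_in _ X]eq_fun do rewrite mxE.
by apply: complex_in_sum => j; exact: complex_inM.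
Qed.

Lemma matrix_in_tr m n (V : T -> 'M[C]_(m, n)) :
  matrix_in V -> matrix_in (fun x => (V x)^T).
Proof. by move=> FV a b; under [X in complex_in _ X]eq_fun do rewrite mxE. Qed.

End Closure.

(** Describes functions built by algebra operations from the real and imaginary parts of the
    entries, without a syntax for them: such a function lies in every algebra that contains these
    parts. *)
Definition test_function N (g : 'M[C]_N -> R) :=
  forall (T : Type) (F : (T -> R) -> Prop) (W : T -> 'M[C]_N),
    function_algebra F -> matrix_in F W -> F (g \o W).

Lemma test_function_avg N (l : seq 'M[C]_N) g : test_function g -> test_function (avg l g).
Proof.
move=> tg T F W FA FW; rewrite /comp /avg.
have [Fc _ FM _] := FA; apply: FM; last exact: Fc.
apply: algebra_sum => // M.
by apply: (tg T F (fun x => M *m W x)) => //; apply: matrix_inM => //; exact: matrix_in_cst.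
Qed.

Lemma Lipschitz_continuous (h : C -> R) :
  (forall z w, `|h z - h w|%:C%C <= `|z - w|) -> continuous h.
Proof.
move=> hL z A /= /(nbhs_ballP (h z))[e /= e0 eA]; apply/nbhs_ballP.
exists e%:C%C => /=; first by rewrite -[0]/((0 : R)%:C%C) ltcR.
move=> w zw; apply: eA; rewrite /ball /= -ltcR; exact: le_lt_trans (hL z w) zw.
Qed.

Lemma Re_Lipschitz (z w : C) : `|complex.Re z - complex.Re w|%:C%C <= `|z - w|.
Proof. by rewrite -raddfB; exact: norm_Re_le. Qed.

Lemma Im_Lipschitz (z w : C) : `|complex.Im z - complex.Im w|%:C%C <= `|z - w|.
Proof. by rewrite -raddfB; exact: norm_Im_le. Qed.

Lemma test_function_continuous N (g : 'M[C]_N -> R) : test_function g -> continuous g.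
Proof.
move=> tg; apply: (tg _ (fun f => continuous f) id); first exact: continuous_algebra.
move=> a b; split => x.
  apply: (@continuous_comp _ _ _ (fun M : 'M[C]_N => M a b) (fun z : C => complex.Re z)).
    exact: coord_continuous.
  by apply: Lipschitz_continuous; exact: Re_Lipschitz.
apply: (@continuous_comp _ _ _ (fun M : 'M[C]_N => M a b) (fun z : C => complex.Im z)).
  exact: coord_continuous.
by apply: Lipschitz_continuous; exact: Im_Lipschitz.
Qed.

End FunctionAlgebra.

Section Haar.
Context {R : realType} {dsp : measure_display} {Omega : measurableType dsp}.
Context {P : probability Omega R} {N : nat}.
Local Notation C := R[i].
Variable U : Omega -> 'M[C]_N.
Hypothesis haarU : haar_unitary P U.

Lemma test_function_measurable g (M : 'M[C]_N) : test_function g ->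
  measurable_fun setT (fun w => g (M *m U w)).
Proof.
move=> tg; case: haarU => _ mU _.
apply: (tg _ (measurable_fun setT) (fun w => M *m U w)); first exact: measurable_algebra.
apply: matrix_inM; first exact: measurable_algebra.
  by apply: matrix_in_cst; exact: measurable_algebra.
by move=> a b; exact: mU.
Qed.

Lemma test_function_measurable1 g : test_function g ->
  measurable_fun setT (fun w => g (U w)).
Proof.
move=> tg; have := test_function_measurable 1%:M tg.
by under eq_fun do rewrite mul1mx.
Qed.

Lemma bounded_integrable (f : Omega -> R) (b : R) : measurable_fun setT f ->
  (forall w, `|f w| <= b) -> P.-integrable setT (EFin \o f).
Proof.
move=> mf fb; apply: measurable_bounded_integrable => //.
- by rewrite -ge0_fin_numE //; exact: fin_num_measure.
- exists b; split; first exact: num_real.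
  by move=> x bx w _ /=; rewrite (le_trans (fb w)) // ltW.
Qed.

Lemma haar_avg l g b : test_function g -> (forall Y, `|g Y| <= b) -> unitary_family l ->
  (\int[P]_w (avg l g (U w))%:E = \int[P]_w (g (U w))%:E)%E.
Proof.
move=> tg gb lU.
have int M : P.-integrable setT (EFin \o (fun w => g (M *m U w))).
  by apply: (@bounded_integrable _ b) => //; exact: test_function_measurable.
rewrite /avg.
under eq_integral => w _ do rewrite mulrC EFinM -sumEFin.
rewrite integralZl //; last first.
  by apply: integrable_sum => // M _; exact: int.
rewrite integral_sum //=.
have -> : (\sum_(M <- l) \int[P]_w (g (M *m U w))%:E =
           \sum_(M <- l) \int[P]_w (g (U w))%:E)%E.
  apply: eq_big_seq => M Ml; case: haarU => _ _; apply.
  - by case: lU => _; exact.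
  - exact: test_function_continuous.
  - by exists b.
have i1 : (\int[P]_w (g (U w))%:E)%E \is a fin_num.
  apply: integrable_fin_num => //.
  have := int 1%:M; apply: eq_integrable => // w _ /=.
  by rewrite mul1mx.
rewrite -(fineK i1) sumEFin -EFinM big_const_seq count_predT iter_addr_0.
by rewrite -(mulr_natr (fine _)) mulrCA mulVf ?mulr1 // size_neq0.
Qed.

Lemma avg_bounded l g (b : R) : unitary_family l -> (forall Y, `|g Y| <= b) ->
  forall Y : 'M[C]_N, `|avg l g Y| <= b.
Proof.
move=> lU gb Y; have s0 : 0 < (size l)%:R :> R by exact: size_gt0.
rewrite /avg normrM (ger0_norm (x := _^-1)) ?invr_ge0 ?ler0n // ler_pdivrMr //.
apply: (le_trans (ler_norm_sum _ _ _)).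
apply: (@le_trans _ _ (\sum_(L <- l) b)); first by apply: ler_sum => M _; exact: gb.
by rewrite big_const_seq count_predT iter_addr_0 mulr_natr.
Qed.

Lemma haar_avgs s g b : test_function g -> (forall Y, `|g Y| <= b) -> unitary_families s ->
  (\int[P]_w (g (U w))%:E = \int[P]_w (avgs s g (U w))%:E)%E.
Proof.
elim: s g => // l s IH g tg gb /unitary_families_cons[lU sU] /=.
rewrite -(haar_avg tg gb lU); apply: IH => //; first exact: test_function_avg.
exact: avg_bounded.
Qed.

(** A bound on the finite average, valid at each unitary, passes to the expectation, so no integral
    over the unitary group has to be computed. *)
Lemma haar_avgs_le s g b (K : R) : test_function g -> (forall Y, `|g Y| <= b) ->
  unitary_families s -> (forall Y, 0 <= g Y) -> 0 <= K ->
  (forall Y, unitary Y -> avgs s g Y <= K) ->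
  (\int[P]_w (g (U w))%:E <= K%:E)%E.
Proof.
move=> tg gb sU g0 K0 gK; rewrite (haar_avgs tg gb sU).
have -> : K%:E = (\int[P]_w (cst K%:E w))%E.
  rewrite integral_cst // -[LHS]mule1; congr (_ * _)%E.
  exact: (esym (probability_setT P)).
have uU w : unitary (U w) by case: haarU => h _ _; exact: h.
have tgs : test_function (avgs s g).
  by elim: s g tg {gb sU g0 gK} => //= l s IH g tg; apply: IH; exact: test_function_avg.
apply: ge0_le_integral => //.
- move=> w _; rewrite lee_fin.
  have := @avgs_le R N s (fun=> 0) g (U w) sU (uU w) (fun W _ => g0 W).
  by rewrite avgs_cst.
- by apply/measurable_EFinP; exact: test_function_measurable1.
- by move=> w _; rewrite lee_fin; exact: gK.
Qed.

End Haar.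

(** * Fourth moment of one entry *)

Section EntryMoment.
Context {R : realType} {n N : nat}.
Local Notation C := R[i].
Variables (A G : 'M[C]_N) (kappa : R).
Hypothesis kappa0 : 0 <= kappa.
Hypothesis opA : forall v : 'cV[C]_N, l2 (A *m v) <= kappa%:C%C * l2 v.
Hypothesis trA : \tr (A *m adjm A) = 1.
Hypothesis unitaryG : unitary G.
Hypothesis flatG : forall x y, `|G x y| ^+ 2 = N%:R^-1.

Lemma Re_avgs s (f : 'M[C]_N -> C) Y :
  avgs s (fun W => complex.Re (f W)) Y = complex.Re (avgs s f Y).
Proof.
elim: s f => //= l s IH f; rewrite -IH; congr (avgs s _ Y); apply/funext => W.
rewrite /avg.
have -> : (size l)%:R^-1 = ((size l)%:R^-1)%:C%C :> C by rewrite fmorphV /= rmorph_nat.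
set S := \sum_(M <- l) f (M *m W).
have -> : \sum_(M <- l) complex.Re (f (M *m W)) = complex.Re S by rewrite raddf_sum.
by case: S => a b /=; rewrite mulr0 subr0.
Qed.

(** The fourth power is unbounded on the space of all matrices, and Haar invariance is stated for
    bounded functions; hence the minimum with [M]. *)
Lemma test_function_entry (a a' b b' : 'I_n -> 'I_N) (z : C) (c M : R) :
  test_function (fun Y => Num.min ((complex.Re (z * entry A a a' b b' Y) - c) ^+ 4) M).
Proof.
move=> T F W FA FW; have [Fc FD FM Fmin] := FA.
apply: (Fmin (fun x => (complex.Re (z * entry A a a' b b' (W x)) - c) ^+ 4)).
apply: (algebraX FA (f := fun x => complex.Re (z * entry A a a' b b' (W x)) - c)).
apply: (FD (fun x => complex.Re (z * entry A a a' b b' (W x))) (fun=> - c)) => //.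
suff : complex_in F (fun x => z * entry A a a' b b' (W x)) by case.
apply: (complex_inM FA (f := fun=> z)); first exact: complex_in_cst.
have FB : matrix_in F (fun x => conj_tr A (W x)).
  apply: (matrix_inM FA (V := fun x => W x *m A)); last exact: matrix_in_tr.
  by apply: (matrix_inM FA FW); exact: matrix_in_cst.
rewrite /entry /pairing.
apply: (complex_in_sum FA) => u; apply: (complex_in_sum FA) => v.
apply: (complex_inM FA (FB _ _)); exact: (complex_in_conj FA (FB _ _)).
Qed.

Lemma entry_le1 (a a' b b' : 'I_n -> 'I_N) (Y : 'M[C]_N) :
  injective a -> injective a' -> injective b -> injective b' -> unitary Y ->
  `|entry A a a' b b' Y| <= 1.
Proof.
move=> aI a'I bI b'I uY; set B := conj_tr A Y.
have sum_le (f g : 'I_n -> 'I_N) : injective f -> injective g ->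
    \sum_x \sum_y `|B (f x) (g y)| ^+ 2 <= 1 :> C.
  move=> fI gI; rewrite -(frobenius_conj_tr trA uY).
  rewrite -(pair_bigA _ (fun x y => `|B x y| ^+ 2)) /=.
  have F0 p : 0 <= \sum_y `|B p y| ^+ 2.
    by apply: sumr_ge0 => q _; rewrite exprn_ge0.
  apply: le_trans (sum_injective_le (F := fun p => \sum_y `|B p y| ^+ 2) fI F0).
  apply: ler_sum => x _; apply: (sum_injective_le (F := fun q => `|B (f x) q| ^+ 2)) => //.
rewrite /entry /pairing pair_bigA /= -(@ler_pXn2r _ 2) ?nnegrE // expr1n.
apply: (le_trans (sumCS _ _)); rewrite -[leRHS]mulr1.
have e (f g : 'I_n -> 'I_N) : \sum_p `|B (f p.1) (g p.2)| ^+ 2 =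
  \sum_x \sum_y `|B (f x) (g y)| ^+ 2 by rewrite pair_bigA.
under [X in _ * X <= _]eq_bigr do rewrite norm_conjc.
rewrite !e; apply: ler_pM; try exact: sum_le;
  by apply: sumr_ge0 => x _; apply: sumr_ge0 => y _; rewrite exprn_ge0.
Qed.

(** Fluctuation and bias are combined by [(x + y)^4 <= 8 (x^4 + y^4)]. The unimodular [z] serves to
    select a real or an imaginary part. *)
Lemma entry_fourth_moment (a a' b b' : 'I_n -> 'I_N) (alpha beta z : C) (Y : 'M[C]_N)
    (d := 8 * kappa) :
  injective a -> injective a' -> injective b -> injective b' -> unitary Y ->
  (forall x, gram G a a' x x = alpha) -> (forall x, gram G b b' x x = beta) ->
  `|z| = 1 ->
  avgs (mixing G) (fun W => (complex.Re (z * entry A a a' b b' W) -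
    complex.Re (z * (alpha * beta))) ^+ 4) Y <=
  8 * (4 * ((2 * N.+1)%:R * d ^+ 2) ^+ 2 + (2 * n%:R * (N%:R^-1) ^+ 2) ^+ 4).
Proof.
move=> aI a'I bI b'I uY ga gb z1.
have d0 : 0 <= d by rewrite /d mulr_ge0.
set c := complex.Re _; pose g := fun W => complex.Re (z * entry A a a' b b' W).
have zL (u v : C) : `|complex.Re (z * u) - complex.Re (z * v)|%:C%C <= `|u - v|.
  by apply: (le_trans (Re_Lipschitz _ _)); rewrite -mulrBr normrM z1 mul1r.
have sU := unitary_mixing unitaryG.
have bd : {in mixing G, forall l, bounded_difference d l g}.
  have h l : l \in [:: G] :: phase_families -> bounded_difference d l g.
    rewrite inE => /orP[/eqP -> K K' uK uK' M M'|].
      by rewrite !inE => /eqP -> /eqP ->; rewrite subrr normr0.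
    exact: (entry_bounded_difference kappa0 opA aI a'I bI b'I zL).
  by move=> l; rewrite mem_cat => /orP[]; exact: h.
have m4 := avgs_fourth_moment d0 sU uY bd.
rewrite size_mixing in m4.
set E := avgs _ g Y in m4.
have Ec : `|E - c| <= 2 * n%:R * (N%:R^-1) ^+ 2.
  rewrite /E /g Re_avgs avgsZ -lecR; apply: (le_trans (zL _ _)).
  apply: (le_trans (avgs_entry_bias trA unitaryG flatG aI a'I bI b'I uY ga gb)).
  by rewrite 2!rmorphM /= rmorphXn /= fmorphV /= !rmorph_nat.
apply: (@le_trans _ _ (avgs (mixing G) (fun W => 8 * (g W - E) ^+ 4 + 8 * (E - c) ^+ 4) Y)).
  apply: avgs_le => // W uW; rewrite -[complex.Re (z * _)]/(g W).
  have -> : g W - c = (g W - E) + (E - c) by rewrite addrA subrK.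
  set x := g W - E; set y := E - c.
  have h1 : 0 <= (x - y) ^+ 2 by exact: sqr_ge0.
  have h2 : 0 <= (x ^+ 2 - y ^+ 2) ^+ 2 by exact: sqr_ge0.
  (* This product equals [8 x^4 + 8 y^4 - (x + y)^4]; its quadratic factor is
     [5 (x + y)^2 + 2 x^2 + 2 y^2]. *)
  have h3 : 0 <= (x - y) ^+ 2 * (7 * x ^+ 2 + 10 * x * y + 7 * y ^+ 2).
    apply: mulr_ge0 => //.
    by have := sqr_ge0 (x + y); have := sqr_ge0 x; have := sqr_ge0 y; nra.
  rewrite -subr_ge0 (_ : _ - _ = (x - y) ^+ 2 * (7 * x ^+ 2 + 10 * x * y + 7 * y ^+ 2)) //.
  by ring.
rewrite avgsD avgs_cst // avgsZ [leRHS]mulrDr.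
apply: lerD; first by rewrite ler_wpM2l.
have -> : (E - c) ^+ 4 = `|E - c| ^+ 4 by rewrite -normrX ger0_norm // exprn_even_ge0.
by rewrite ler_wpM2l // lerXn2r ?nnegrE // (le_trans _ Ec).
Qed.

End EntryMoment.

(** * Fourth moment of the output *)

Section QuarticDeviation.
Context {R : realType}.
Local Notation C := R[i].

(** The real part of [component b * z] is the real part of [z] for [true] and its imaginary part for
    [false], so one argument covers both. *)
Definition component (b : bool) : C := if b then 1 else - 'i%C.

Lemma component_norm b : `|component b| = 1.
Proof.
case: b => /=; first by rewrite normr1.
by rewrite normrN normc_def /= expr0n /= expr1n add0r sqrtr1.
Qed.

(** A single polynomial quantity: its expectation is bounded term by term, and it controls every
    entry, hence the spectrum and the traces of powers. *)
Definition quartic_deviation m (c : C) (Z : 'M[C]_m) : R :=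
  \sum_(x : ('I_m * 'I_m) * bool)
    (complex.Re (component x.2 * Z x.1.1 x.1.2) -
     complex.Re (component x.2 * (c *+ (x.1.1 == x.1.2)))) ^+ 4.

Lemma quartic_deviation_ge0 m c (Z : 'M[C]_m) : 0 <= quartic_deviation c Z.
Proof. by apply: sumr_ge0 => x _; rewrite exprn_even_ge0. Qed.

Lemma quartic_deviation_entry m c (Z : 'M[C]_m) (e : R) p q : 0 <= e ->
  quartic_deviation c Z <= e ^+ 4 -> `|Z p q - c *+ (p == q)| <= (2 * e)%:C%C.
Proof.
move=> e0 He.
have le_e b : `|complex.Re (component b * (Z p q - c *+ (p == q)))| <= e.
  rewrite -(@ler_pXn2r _ 4) ?nnegrE // -normrX ger0_norm ?exprn_even_ge0 //.
  apply: le_trans He; rewrite /quartic_deviation (bigD1 (p, q, b)) //=.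
  rewrite mulrBr raddfB lerDl; apply: sumr_ge0 => x _.
  by rewrite exprn_even_ge0.
apply: (le_trans (norm_le_ReIm _)); rewrite lecR mulr_natl mulr2n; apply: lerD.
  by have := le_e true; rewrite mul1r.
have ReNi (z : C) : complex.Re (- 'i%C * z) = complex.Im z.
  by case: z => x y /=; ring.
by have := le_e false; rewrite ReNi.
Qed.

End QuarticDeviation.

Section OneDimension.
Context {R : realType} {dsp : measure_display} {Omega : measurableType dsp}.
Context {P : probability Omega R} {k n d : nat}.
Local Notation C := R[i].
Variables (A : 'M[C]_d) (U : Omega -> 'M[C]_(k * n)) (c : R).
Hypotheses (k0 : (0 < k)%N) (kn : (k <= n)%N) (dN : (d <= k * n)%N).
Hypothesis trA : \tr (A *m adjm A) = 1.
Hypothesis opA : opnorm A <= c / Num.sqrt n%:R.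
Hypothesis haarU : haar_unitary P U.

Definition output (w : Omega) : 'M[C]_(k * k) :=
  PhiC_tens (firstcols d (U w)) (psi_vec A *m adjm (psi_vec A)).

Lemma output_unitary w : unitary (U w).
Proof. by case: haarU. Qed.

Lemma output_le1 w p q : `|output w p q| <= 1.
Proof.
rewrite /output PhiC_tensE //; apply: entry_le1 => //; try exact: row_block_inj.
  exact: padding_trace.
exact: output_unitary.
Qed.

Let n0 : (0 < n)%N. Proof. exact: leq_trans kn. Qed.

(** At most [4 k n] families, each with squared difference [(8 c^2 / n)^2 = 64 c^4 / n^2], give
    [256 k c^4 / n]. The bias is at most [2 / n], and its fourth power at most [16 / n^2]. *)
Definition moment_const : R := 8 * (4 * (256 * k%:R * c ^+ 4) ^+ 2 + 16).

Lemma moment_const_bound (kappa := (c / Num.sqrt n%:R) ^+ 2) :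
  8 * (4 * ((2 * (k * n).+1)%:R * (8 * kappa) ^+ 2) ^+ 2 +
       (2 * n%:R * ((k * n)%:R^-1) ^+ 2) ^+ 4) <= moment_const / n%:R ^+ 2.
Proof.
have np : 0 < n%:R :> R by rewrite ltr0n.
have n1 : 1 <= n%:R :> R by rewrite ler1n.
have k1 : 1 <= k%:R :> R by rewrite ler1n.
rewrite /moment_const -[leRHS]mulrA ler_pM2l // [leRHS]mulrDl; apply: lerD.
  have -> : kappa = c ^+ 2 / n%:R by rewrite /kappa exprMn exprVn sqr_sqrtr // ltW.
  rewrite -[leRHS]mulrA ler_pM2l // -expr_div_n.
  rewrite lerXn2r ?nnegrE //.
  - by rewrite mulr_ge0 // sqr_ge0.
  - by rewrite divr_ge0 ?(ltW np) // mulr_ge0 // ?exprn_even_ge0 // mulr_ge0.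
  have -> : (8 * (c ^+ 2 / n%:R)) ^+ 2 = 64 * c ^+ 4 / n%:R ^+ 2 :> R.
    by field; rewrite gt_eqF.
  apply: (@le_trans _ _ (4 * k%:R * n%:R * (64 * c ^+ 4 / n%:R ^+ 2))).
    rewrite ler_wpM2r //.
      by rewrite divr_ge0 ?exprn_even_ge0 // mulr_ge0 // exprn_even_ge0.
    rewrite -!natrM ler_nat; have : (0 < k * n)%N by rewrite muln_gt0 k0.
    by move: (k * n)%N (mulnA 4 k n) => m <- m0; lia.
  by rewrite le_eqVlt; apply/orP; left; apply/eqP; field; rewrite gt_eqF.
have h : 2 * n%:R * (k * n)%:R^-1 ^+ 2 <= 2 / n%:R :> R.
  rewrite natrM invfM exprMn.
  have -> : 2 * n%:R * (k%:R^-1 ^+ 2 * n%:R^-1 ^+ 2) = k%:R^-1 ^+ 2 * (2 / n%:R) :> R.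
    by field; rewrite gt_eqF //= gt_eqF // (lt_le_trans _ k1).
  apply: ler_piMl; first by rewrite divr_ge0 // ltW.
  by apply: exprn_ile1; rewrite ?invr_ge0 ?invf_le1 // (lt_le_trans _ k1).
apply: (@le_trans _ _ ((2 / n%:R) ^+ 4)).
  rewrite lerXn2r ?nnegrE ?divr_ge0 ?(ltW np) // mulr_ge0 ?sqr_ge0 // mulr_ge0 // ltW //.
have -> : (2 / n%:R) ^+ 4 = 16 / n%:R ^+ 2 * (n%:R^-1) ^+ 2 :> R by field; rewrite gt_eqF.
apply: ler_piMr; first by rewrite divr_ge0 ?exprn_even_ge0.
by apply: exprn_ile1; rewrite ?invr_ge0 ?invf_le1 // ltW.
Qed.

Definition limit_entry : C := ((k * k)%:R^-1).

Definition deviation_part (x : ('I_(k * k) * 'I_(k * k)) * bool) (w : Omega) : R :=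
  (complex.Re (component x.2 * output w x.1.1 x.1.2) -
     complex.Re (component x.2 * (limit_entry *+ (x.1.1 == x.1.2)))) ^+ 4.

Lemma measurable_output : matrix_in (measurable_fun setT) output.
Proof.
have alg := @measurable_algebra R _ Omega.
have mU : matrix_in (measurable_fun setT) U by case: haarU => _ h _ a b; exact: h.
have mB : matrix_in (measurable_fun setT) (fun w => conj_tr (padding (N := k * n) A) (U w)).
  apply: (matrix_inM alg (V := fun x => U x *m _)); last exact: matrix_in_tr.
  by apply: (matrix_inM alg mU); exact: matrix_in_cst.
move=> p q; under [X in complex_in _ X]eq_fun do rewrite /output PhiC_tensE //.
rewrite /entry /pairing.
apply: (complex_in_sum alg) => u; apply: (complex_in_sum alg) => v.
apply: (complex_inM alg (mB _ _)); exact: (complex_in_conj alg (mB _ _)).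
Qed.

Lemma measurable_deviation_part x : measurable_fun setT (deviation_part x).
Proof.
have alg := @measurable_algebra R _ Omega.
apply: (algebraX alg); have [_ FD _ _] := alg; apply: FD; last exact: measurable_cst.
suff : complex_in (measurable_fun setT) (fun w => component x.2 * output w x.1.1 x.1.2) by case.
apply: (complex_inM alg); first exact: complex_in_cst.
exact: measurable_output.
Qed.

Lemma integral_deviation_part x :
  (\int[P]_w (deviation_part x w)%:E <= (moment_const / n%:R ^+ 2)%:E)%E.
Proof.
have [wk wkP] := prim_root_exists (R := R) k0.
have [wn wnP] := prim_root_exists (R := R) n0.
pose G := entangled_fourier (k := k) (n := n) wk wn.
case: x => -[p q] b.
set i := (mxtens_unindex p).1; set j := (mxtens_unindex p).2.
set i' := (mxtens_unindex q).1; set j' := (mxtens_unindex q).2.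
pose alpha : C := (i == i')%:R / k%:R; pose beta : C := (j == j')%:R / k%:R.
have ab : limit_entry *+ (p == q) = alpha * beta.
  rewrite /alpha /beta /limit_entry mulrACA -invfM -!natrM mulnb.
  rewrite -(can_eq (@mxtens_unindexK k k)).
  rewrite -[mxtens_unindex p == _]/((i, j) == (i', j')) xpair_eqE.
  by case: (_ && _); rewrite ?mulr1n ?mulr0n ?mul1r ?mul0r.
pose z : C := component b.
pose f Y := complex.Re (z * entry (padding (N := k * n) A) (row_block i) (row_block i')
   (row_block j) (row_block j') Y) - complex.Re (z * (alpha * beta)).
(* On unitaries both the entry and its limit have modulus at most 1, so [|f| <= 2] and truncation at
   [16 = 2^4] changes nothing there. *)
pose g Y := Num.min (f Y ^+ 4) 16.
have tg : test_function g by exact: test_function_entry.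
have kr : 1 <= k%:R :> C by rewrite ler1n.
have dE w : deviation_part (p, q, b) w = g (U w).
  rewrite /deviation_part /= ab /output PhiC_tensE // /g min_l //.
  rewrite -[X in X ^+ 4]/(f (U w)).
  have f2 : `|f (U w)| <= 2.
    rewrite /f -lecR; apply: (le_trans (Re_Lipschitz _ _)).
    rewrite -mulrBr normrM component_norm mul1r (le_trans (ler_normB _ _)) //.
    have -> : (2 : R)%:C%C = 1 + 1 :> C by rewrite rmorph_nat.
    apply: lerD.
      apply: entry_le1; [exact: padding_trace|exact: row_block_inj|exact: row_block_inj|
        exact: row_block_inj|exact: row_block_inj|exact: output_unitary].
    rewrite -ab /limit_entry; case: (p == q); rewrite ?normr0 //= mulr1n ger0_norm ?invr_ge0 //.
    by rewrite natrM invfM mulr_ile1 ?invr_ge0 ?invf_le1 // (lt_le_trans _ kr).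
  rewrite -[_ ^+ 4](ger0_norm (exprn_even_ge0 _ _)) // normrX.
  by rewrite (_ : 16 = 2 ^+ 4 :> R) ?lerXn2r ?nnegrE // -natrX.
under eq_integral => w _ do rewrite dE.
have g0 Y : 0 <= g Y by rewrite /g le_min exprn_even_ge0 //= ler0n.
have k00 : 0 <= (c / Num.sqrt n%:R) ^+ 2 by exact: sqr_ge0.
have uG : unitary G by exact: unitary_entangled_fourier.
apply: (haar_avgs_le haarU (b := 16) tg _ (unitary_mixing uG) g0).
- by move=> Y; rewrite ger0_norm // /g ge_min lexx orbT.
- rewrite divr_ge0 ?sqr_ge0 // /moment_const mulr_ge0 // addr_ge0 // mulr_ge0 //.
  exact: sqr_ge0.
move=> Y uY; apply: le_trans moment_const_bound.
apply: (@le_trans _ _ (avgs (mixing G) (fun W => f W ^+ 4) Y)).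
  apply: avgs_le => // [|W uW]; first exact: unitary_mixing.
  by rewrite /g ge_min lexx.
apply: entry_fourth_moment => //; try exact: row_block_inj.
- by move=> v; exact: padding_opnorm.
- exact: padding_trace.
- exact: entangled_fourier_flat.
- by move=> x; exact: gram_entangled_fourier.
- by move=> x; exact: gram_entangled_fourier.
- exact: component_norm.
Qed.

Lemma measurable_quartic_deviation :
  measurable_fun setT (fun w => quartic_deviation limit_entry (output w)).
Proof.
apply: (algebra_sum (measurable_algebra Omega)) => x; exact: measurable_deviation_part.
Qed.

Definition total_const : R := #|{: ('I_(k * k) * 'I_(k * k)) * bool}|%:R * moment_const.

Lemma integral_quartic_deviation :
  (\int[P]_w (quartic_deviation limit_entry (output w))%:E <=
   (total_const / n%:R ^+ 2)%:E)%E.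
Proof.
under eq_integral => w _ do rewrite /quartic_deviation -sumEFin.
rewrite (ge0_integral_sum P measurableT (f := fun x w => (deviation_part x w)%:E)).
- apply: (@le_trans _ _ (\sum_(x : ('I_(k * k) * 'I_(k * k)) * bool)
    (moment_const / n%:R ^+ 2)%:E)%E).
    by apply: lee_sum => x _; exact: integral_deviation_part.
  by rewrite sumEFin sumr_const -[_ *+ _]mulr_natl mulrA lexx.
- by move=> x; apply/measurable_EFinP; exact: measurable_deviation_part.
- by move=> x w _; rewrite lee_fin exprn_even_ge0.
Qed.

End OneDimension.

(** * Convergence *)

Section NearScalar.
Context {R : realType}.
Local Notation C := R[i].

Lemma eigsE m (Z : 'M[C]_m) : char_poly Z = \prod_(z <- eigs Z) ('X - z%:P).
Proof. by apply/eqP; exact: (xchooseP (char_poly_splits Z)). Qed.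

Lemma size_eigs m (Z : 'M[C]_m) : size (eigs Z) = m.
Proof.
by apply: succn_inj; rewrite -(size_prod_XsubC (eigs Z) id) -eigsE size_char_poly.
Qed.

Lemma eigs_eigenvalue m (Z : 'M[C]_m) z : z \in eigs Z -> eigenvalue Z z.
Proof. by move=> zZ; rewrite eigenvalue_root_char eigsE root_prod_XsubC. Qed.

(** Compare l1 norms in the equation [v (Z - c I) = (z - c) v] for a left eigenvector [v]. *)
Lemma eigenvalue_near m (Z : 'M[C]_m) (c e z : C) :
  (forall p q, `|Z p q - c *+ (p == q)| <= e) -> z \in eigs Z -> `|z - c| <= m%:R * e.
Proof.
move=> Ze /eigs_eigenvalue /eigenvalueP[v vZ v0].
have s0 : 0 < \sum_q `|v 0 q|.
  rewrite lt0r sumr_ge0 // andbT; apply: contra v0 => /eqP v0.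
  apply/eqP/rowP => q; rewrite mxE; apply/eqP; rewrite -normr_eq0.
  by move/eqP: v0; rewrite psumr_eq0 // => /allP/(_ q); rewrite mem_index_enum => /(_ isT).
rewrite -(ler_pM2r s0) mulr_sumr.
apply: (@le_trans _ _ (\sum_q \sum_p `|v 0 p| * e)).
  apply: ler_sum => q _; rewrite -normrM.
  have -> : (z - c) * v 0 q = \sum_p v 0 p * (Z p q - c *+ (p == q)).
    have := congr1 (fun M : 'rV[C]_m => M 0 q) vZ; rewrite !mxE => vq.
    under eq_bigr do rewrite mulrBr.
    rewrite sumrB vq mulrBl; congr (_ - _).
    rewrite (bigD1 q) //= eqxx mulr1n big1 ?addr0; first by rewrite mulrC.
    by move=> p pq; rewrite (negbTE pq) mulr0n mulr0.
  apply: (le_trans (ler_norm_sum _ _ _)); apply: ler_sum => p _.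
  by rewrite normrM ler_wpM2l.
by rewrite sumr_const card_ord -mulr_suml -[_ *+ _]mulr_natl mulrA mulrAC.
Qed.

Lemma emp_eig_near m (Z : 'M[C]_m) (c : C) (f : C -> R) (e : R) : (0 < m)%N ->
  (forall z, z \in eigs Z -> `|f z - f c| <= e) -> `|emp_eig Z f - f c| <= e.
Proof.
move=> m0 fe; have mp : 0 < m%:R :> R by rewrite ltr0n.
have -> : emp_eig Z f - f c = m%:R^-1 * \sum_(z <- eigs Z) (f z - f c).
  rewrite /emp_eig sumrB mulrBr; congr (_ - _).
  rewrite big_const_seq count_predT iter_addr_0 size_eigs -(mulr_natl (f c)) mulKf //.
  by rewrite gt_eqF.
rewrite normrM ger0_norm ?invr_ge0 // ler_pdivrMl //.
apply: (le_trans (ler_norm_sum _ _ _)).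
apply: (@le_trans _ _ (\sum_(z <- eigs Z) e)).
  by rewrite big_seq [leRHS]big_seq; apply: ler_sum => z; exact: fe.
by rewrite big_const_seq count_predT iter_addr_0 size_eigs mulr_natl.
Qed.

(** Error constant of the telescoping [Z^(r+1) - c^(r+1) = Z (Z^r - c^r) + c^r (Z - c)] when [c] and
    the entries of [Z] have modulus at most 1; the matrix product costs the factor [m]. *)
Fixpoint power_const (m p : nat) : R :=
  if p is p'.+1 then m%:R * power_const m p' + 1 else 0.

Lemma power_const_ge0 m p : 0 <= power_const m p.
Proof. by elim: p => //= p IH; rewrite addr_ge0 // mulr_ge0. Qed.

Lemma power_near m (Z : 'M[C]_m) (c e : R) r p q : 0 <= c -> c <= 1 ->
  (forall p q, `|Z p q| <= 1) ->
  (forall p q, `|Z p q - c%:C%C *+ (p == q)| <= e%:C%C) ->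
  `|(Z ^+ r) p q - (c ^+ r)%:C%C *+ (p == q)| <= (power_const m r * e)%:C%C.
Proof.
move=> c0 c1 Z1 Ze; elim: r p q => [|r IH] p q.
  by rewrite !expr0 mul0r mxE subrr normr0.
have -> : (Z ^+ r.+1) p q - (c ^+ r.+1)%:C%C *+ (p == q) =
    \sum_s Z p s * ((Z ^+ r) s q - (c ^+ r)%:C%C *+ (s == q)) +
    (c ^+ r)%:C%C * (Z p q - c%:C%C *+ (p == q)).
  under eq_bigr do rewrite mulrBr.
  rewrite sumrB exprS -[Z * _]/(Z *m _) mxE -addrA; congr (_ + _).
  rewrite (bigD1 q) //= eqxx mulr1n big1 ?addr0; last first.
    by move=> s sq; rewrite (negbTE sq) mulr0n mulr0.
  by rewrite mulrBr mulrnAr exprSr rmorphM /= [Z p q * _]mulrC addKr.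
apply: (le_trans (ler_normD _ _)).
rewrite [power_const _ _]/= mulrDl mul1r rmorphD /=; apply: lerD.
  apply: (le_trans (ler_norm_sum _ _ _)).
  apply: (@le_trans _ _ (\sum_(s < m) (power_const m r * e)%:C%C)).
    apply: ler_sum => s _; rewrite normrM -[leRHS]mul1r.
    by apply: ler_pM.
  by rewrite sumr_const card_ord -mulrA mulr_natl rmorphMn.
rewrite normrM -[leRHS]mul1r; apply: ler_pM => //.
by rewrite ger0_norm ?ler0c ?exprn_ge0 // -[1]/((1 : R)%:C%C) lecR exprn_ile1.
Qed.

Lemma trace_power_near m (Z : 'M[C]_m) (c e : R) r : 0 <= c -> c <= 1 ->
  (forall p q, `|Z p q| <= 1) ->
  (forall p q, `|Z p q - c%:C%C *+ (p == q)| <= e%:C%C) ->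
  `|complex.Re (\tr (Z ^+ r)) - m%:R * c ^+ r| <= m%:R * (power_const m r * e).
Proof.
move=> c0 c1 Z1 Ze.
have -> : m%:R * c ^+ r = complex.Re (\sum_(p < m) (c ^+ r)%:C%C).
  by rewrite -rmorph_sum /= sumr_const card_ord mulr_natl.
rewrite -lecR; apply: (le_trans (Re_Lipschitz _ _)).
rewrite /mxtrace -sumrB; apply: (le_trans (ler_norm_sum _ _ _)).
have -> : (m%:R * (power_const m r * e))%:C%C =
    \sum_(p < m) (power_const m r * e)%:C%C :> C.
  by rewrite sumr_const card_ord mulr_natl rmorphMn.
apply: ler_sum => p _.
by have := power_near r p p c0 c1 Z1 Ze; rewrite eqxx mulr1n.
Qed.

End NearScalar.

Section AlmostSure.
Context {R : realType} {dsp : measure_display} {Omega : measurableType dsp}.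
Variable P : probability Omega R.

Lemma inv_square_sum m : \sum_(0 <= j < m) (j.+1%:R ^+ 2)^-1 <= 2 :> R.
Proof.
(* The stronger bound is inductive, since [1 / x^2 <= 2 / x - 2 / (x + 1)] for [x >= 1]. *)
suff : \sum_(0 <= j < m) (j.+1%:R ^+ 2)^-1 <= 2 - 2 / m.+1%:R :> R.
  by move=> /le_trans; apply; rewrite gerBl divr_ge0.
elim: m => [|m IH]; first by rewrite big_geq // divr1 subrr.
rewrite big_nat_recr //=; apply: (le_trans (lerD IH (lexx _))).
rewrite -subr_ge0 -(natr1 m.+1); set x : R := m.+1%:R.
have x1 : 1 <= x by rewrite ler1n.
have x0 : 0 < x by rewrite (lt_le_trans _ x1).
have -> : 2 - 2 / (x + 1) - (2 - 2 / x + (x ^+ 2)^-1) = (x - 1) / (x ^+ 2 * (x + 1)).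
  by field; rewrite !gt_eqF // addr_gt0.
by rewrite divr_ge0 ?subr_ge0 // mulr_ge0 ?sqr_ge0 // addr_ge0 // ltW.
Qed.

(** The expectation of the whole series is finite, so the series converges almost surely and its
    terms tend to 0. *)
Lemma ae_cvg0 (X : nat -> Omega -> R) (K : R) : 0 <= K ->
  (forall n, measurable_fun setT (X n)) -> (forall n w, 0 <= X n w) ->
  (forall n, \int[P]_w (X n w)%:E <= (K / n%:R ^+ 2)%:E)%E ->
  {ae P, forall w, forall e : R, 0 < e -> exists N, forall n, (N <= n)%N -> X n w < e}.
Proof.
move=> K0 mX X0 XK.
pose S w := (\sum_(0 <= j <oo) (X j.+1 w)%:E)%E.
have mS j : measurable_fun setT (fun w => (X j.+1 w)%:E).
  by apply/measurable_EFinP; exact: mX.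
have S0 j w : setT w -> (0 <= (X j.+1 w)%:E)%E by rewrite lee_fin.
have intS : (\int[P]_w S w <= (K * 2)%:E)%E.
  rewrite /S (integral_nneseries P measurableT mS S0).
  apply: lime_le.
    by apply: is_cvg_nneseries => j _ _; apply: integral_ge0 => w _; rewrite lee_fin.
  apply: nearW => m; apply: (@le_trans _ _ (\sum_(0 <= j < m) (K / j.+1%:R ^+ 2)%:E)%E).
    by apply: lee_sum => j _; exact: XK.
  by rewrite sumEFin lee_fin -mulr_sumr ler_wpM2l // inv_square_sum.
have mSS : measurable_fun setT S.
  by apply: ge0_emeasurable_sum => // j w _ _; rewrite lee_fin.
have iS : P.-integrable setT S.
  apply/integrableP; split=> //.
  under eq_integral => w _.
    rewrite gee0_abs; last by apply: nneseries_ge0 => j _ _; rewrite lee_fin.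
    over.
  by apply: (le_lt_trans intS); rewrite ltry.
have := integrable_ae measurableT iS.
apply: filterS => w /(_ I) Sw e e0.
have cv : cvgn (series (fun j => X j.+1 w)).
  apply: nondecreasing_is_cvgn.
    by apply/nondecreasing_seqP => m; rewrite /series /= big_nat_recr //= lerDl.
  exists (fine (S w)) => _ [m _ <-]; rewrite -lee_fin fineK // /series /= -sumEFin.
  by apply: nneseries_lim_ge => j _; rewrite lee_fin.
have /cvgrPdist_lt/(_ _ e0)[N _ NP] := cvg_series_cvg_0 cv.
(* The successor undoes the shift of the series, which starts at [X 1]. *)
exists N.+1 => -[//|n] Nn; have := NP n Nn.
by rewrite /= sub0r normrN ger0_norm.
Qed.

End AlmostSure.

Section Limits.
Context {R : realType}.
Local Notation C := R[i].

(** The fourth root of [D] is replaced by the bound [e + D / e^3], valid for every [e > 0]. Being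
    affine in [D], it can be integrated using only the expectation of [D]. *)
Lemma quartic_deviation_lt m (c : C) (Z : 'M[C]_m) (e : R) : 0 < e ->
  forall p q, `|Z p q - c *+ (p == q)| <=
    (2 * (e + quartic_deviation c Z / e ^+ 3))%:C%C.
Proof.
move=> e0 p q; have D0 := quartic_deviation_ge0 c Z.
set D := quartic_deviation c Z in D0 *.
have De0 : 0 <= D / e ^+ 3 by rewrite divr_ge0 // exprn_ge0 // ltW.
apply: quartic_deviation_entry; first by rewrite addr_ge0 // ltW.
have [De|De] := leP D (e ^+ 4).
  by apply: (le_trans De); rewrite lerXn2r ?nnegrE ?lerDl // ?addr_ge0 // ltW.
have eD : e <= D / e ^+ 3.
  by rewrite ler_pdivlMr ?exprn_gt0 // -exprS ltW.
set y := D / e ^+ 3 in De0 eD *.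
have -> : quartic_deviation c Z = y * e ^+ 3 by rewrite divfK // gt_eqF ?exprn_gt0.
apply: (@le_trans _ _ (y * y ^+ 3)).
  by rewrite ler_wpM2l // lerXn2r ?nnegrE // ltW.
by rewrite -exprS lerXn2r ?nnegrE ?addr_ge0 ?lerDr // ltW.
Qed.

Lemma real_limit_entry (k : nat) : limit_entry (R := R) (k := k) = ((k * k)%:R^-1)%:C%C.
Proof. by rewrite /limit_entry fmorphV /= rmorph_nat. Qed.

Lemma emp_eig_limit m (c : C) (f : C -> R) (e : R) : (0 < m)%N -> 0 < e -> continuous f ->
  exists2 r : R, 0 < r & forall Z : 'M[C]_m,
    quartic_deviation c Z < r -> `|emp_eig Z f - f c| < e.
Proof.
move=> m0 e0 cf.
have e2 : 0 < e / 2 by rewrite divr_gt0.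
have /(nbhs_ballP c)[s /= s0 sf] := cf c (ball (f c) (e / 2)) (nbhsx_ballx (f c) (e / 2) e2).
pose a := complex.Re s.
have sE : s = a%:C%C by rewrite RRe_real // gtr0_real.
have a0 : 0 < a by rewrite -ltcR -sE.
have mp : 0 < m%:R :> R by rewrite ltr0n.
(* Entries within [2 b] of [c I] put the eigenvalues within [2 m b = a / 2] of [c], inside the
   continuity radius [a]. *)
pose b := a / (4 * m%:R).
have b0 : 0 < b by rewrite divr_gt0 // mulr_gt0.
exists (b ^+ 4); first exact: exprn_gt0.
move=> Z ZD.
apply: (@le_lt_trans _ _ (e / 2)); last by rewrite gtr_pMr // invf_lt1 // ltr1n.
apply: emp_eig_near => // z zZ; rewrite distrC; apply/ltW.
apply: (sf z); rewrite /ball /= distrC sE.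
have Zb p q := quartic_deviation_entry p q (ltW b0) (ltW ZD).
apply: (le_lt_trans (eigenvalue_near Zb zZ)).
have -> : m%:R = (m%:R : R)%:C%C :> C by rewrite rmorph_nat.
rewrite -rmorphM /= ltcR.
have -> : m%:R * (2 * b) = a / 2 by rewrite /b; field; rewrite gt_eqF.
by rewrite gtr_pMr // invf_lt1 // ltr1n.
Qed.

End Limits.

Section TraceExpectation.
Context {R : realType} {dsp : measure_display} {Omega : measurableType dsp}.
Context {P : probability Omega R}.
Local Notation C := R[i].

(** The free [e] balances the two errors: it is chosen small first, and [K] then decays with the
    dimension. *)
Lemma expectation_trace_power m (Z : Omega -> 'M[C]_m) (c e K : R) r : 0 <= c -> c <= 1 ->
  matrix_in (measurable_fun setT) Z -> (forall w p q, `|Z w p q| <= 1) ->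
  measurable_fun setT (fun w => quartic_deviation c%:C%C (Z w)) ->
  (\int[P]_w (quartic_deviation c%:C%C (Z w))%:E <= K%:E)%E -> 0 < e ->
  `|Rintegral P setT (fun w => complex.Re (\tr (Z w ^+ r))) - m%:R * c ^+ r| <=
  2 * m%:R * power_const m r * (e + K / e ^+ 3).
Proof.
move=> c0 c1 mZ Z1 mD DK e0.
have e3 : 0 < e ^+ 3 by rewrite exprn_gt0.
pose D w := quartic_deviation c%:C%C (Z w).
have D0 w : 0 <= D w by exact: quartic_deviation_ge0.
have iD : P.-integrable setT (EFin \o D).
  apply/integrableP; split; first exact/measurable_EFinP.
  under eq_integral => w _ do rewrite gee0_abs ?lee_fin //.
  by apply: (le_lt_trans DK); rewrite ltry.
have near w : `|complex.Re (\tr (Z w ^+ r)) - m%:R * c ^+ r| <=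
    m%:R * (power_const m r * (2 * (e + D w / e ^+ 3))).
  apply: trace_power_near => //; exact: quartic_deviation_lt.
pose B : R := 2 * m%:R * power_const m r.
have B0 : 0 <= B by rewrite mulr_ge0 ?power_const_ge0 // mulr_ge0.
have alg := @measurable_algebra R _ Omega.
have mT : measurable_fun setT (fun w => complex.Re (\tr (Z w ^+ r))).
  have mP : matrix_in (measurable_fun setT) (fun w => Z w ^+ r).
    elim: r {near B B0} => [|r IH]; first exact: (matrix_in_cst alg).
    under [X in matrix_in _ X]eq_fun do rewrite exprS.
    exact: (matrix_inM alg mZ IH).
  suff : complex_in (measurable_fun setT) (fun w => \tr (Z w ^+ r)) by case.
  by apply: (complex_in_sum alg) => p; exact: mP.
pose L : R := m%:R * c ^+ r.
pose f w := complex.Re (\tr (Z w ^+ r)).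
have iL (x : R) : P.-integrable setT (EFin \o (fun=> x)).
  by apply: (@bounded_integrable _ _ _ _ _ `|x|).
have iZ : P.-integrable setT (EFin \o (fun w => B / e ^+ 3 * D w)).
  exact: (integrableZl measurableT (B / e ^+ 3) iD).
have iH : P.-integrable setT (EFin \o (fun w => B * e + B / e ^+ 3 * D w)).
  exact: (integrableD measurableT (iL (B * e)) iZ).
have mF : measurable_fun setT (fun w => f w - L).
  by apply: measurable_funB => //; exact: measurable_cst.
have near' w : `|f w - L| <= B * e + B / e ^+ 3 * D w.
  apply: (le_trans (near w)); rewrite le_eqVlt; apply/orP; left; apply/eqP.
  by rewrite /B; field; rewrite gt_eqF.
have iF : P.-integrable setT (EFin \o (fun w => f w - L)).
  apply: (le_integrable measurableT _ _ iH); first exact/measurable_EFinP.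
  by move=> w _ /=; rewrite lee_fin (le_trans (near' w)) // ler_norm.
have if_ : P.-integrable setT (EFin \o f).
  have := integrableD measurableT iF (iL L).
  by apply: eq_integrable => // w _ /=; rewrite -EFinD subrK.
have P1 : fine (P setT) = 1 by rewrite probability_setT.
have -> : Rintegral P setT f - L = Rintegral P setT (fun w => f w - L).
  by rewrite (RintegralB measurableT if_ (iL L)) Rintegral_cst // P1 mulr1.
apply: (le_trans (le_normr_Rintegral measurableT iF)).
have iN : P.-integrable setT (EFin \o (fun w => `|f w - L|)) by exact: integrable_norm.
apply: (@le_trans _ _ (Rintegral P setT (fun w => B * e + B / e ^+ 3 * D w))).
  by apply: le_Rintegral => // w _; exact: near'.
rewrite (RintegralD measurableT (iL (B * e)) iZ).
rewrite Rintegral_cst // P1 mulr1 RintegralZl // mulrDr lerD2l.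
rewrite -mulrA ler_wpM2l // mulrC ler_pM2r ?invr_gt0 //.
have Dfin : (\int[P]_w (D w)%:E)%E \is a fin_num by exact: integrable_fin_num.
by rewrite -lee_fin /Rintegral fineK.
Qed.

End TraceExpectation.

Unset Implicit Arguments.

Theorem theorem4p1 (R : realType) (dsp : measure_display) (Omega : measurableType dsp)
  (P : probability Omega R) (k : nat) (t : R) (dim : nat -> nat)
  (A : forall n : nat, 'M[R[i]]_(dim n))
  (U : forall n : nat, Omega -> 'M[R[i]]_(k * n)) :
  let S := fun n : nat => (0 < n)%N /\ exists m : nat, m%:R = t * n%:R * k%:R in
  (2 <= k)%N -> 0 < t -> t <= 1 ->
  (forall n, S n -> (dim n)%:R = t * n%:R * k%:R) ->
  (forall n, S n -> \tr (A n *m adjm (A n)) = 1) ->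
  (* Assumption 1 *)
  (exists (m : R[i]) (C : R) (N : nat), forall n, S n -> (N <= n)%N ->
      `| \tr (A n) / real_complex R (Num.sqrt ((dim n)%:R : R)) - m | <= real_complex R (C / (n%:R ^+ 2))) ->
  (* Assumption 2 *)
  (exists (C : R) (N : nat), forall n, S n -> (N <= n)%N ->
      opnorm (A n) <= C / Num.sqrt (n%:R : R)) ->
  (forall n, S n -> haar_unitary P (U n)) ->
  let Z := fun n w => PhiC_tens (firstcols (dim n) (U n w))
                         (psi_vec (A n) *m adjm (psi_vec (A n))) in
  {ae P, forall w, forall f : R[i] -> R, continuous f -> (exists M, forall x, `|f x| <= M) ->
      cvg_along S (fun n => emp_eig (Z n w) f) (f (real_complex R ((k * k)%:R)^-1))}
  /\
  (forall p : nat, (1 <= p)%N ->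
      cvg_along S (fun n => Rintegral P setT (fun w => complex.Re (\tr (Z n w ^+ p))))
                  ((k ^ 2)%:R * (((k ^ 2)%:R)^-1) ^+ p)).
Proof.
move=> S k2 t0 t1 dimE trA _ [c [N0 opA]] haarU Z.
have k0 : (0 < k)%N by exact: ltnW.
have kk0 : (0 < k * k)%N by rewrite muln_gt0 k0.
have dN n : S n -> (dim n <= k * n)%N.
  move=> Sn; rewrite -(ler_nat R) (dimE n Sn) natrM [leRHS]mulrC.
  by rewrite ler_wpM2r // ler_piMl.
pose K : R := total_const (k := k) c.
have K0 : 0 <= K.
  by rewrite mulr_ge0 // mulr_ge0 // addr_ge0 // mulr_ge0 // sqr_ge0.
pose l : R := (k * k)%:R^-1.
have lE : limit_entry = l%:C%C := real_limit_entry k.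
(* The entangled Fourier matrix requires [k <= n], and the operator norm bound holds from [N0]
   on. *)
pose good n := S n /\ (maxn N0 k <= n)%N.
have op n : good n -> opnorm (A n) <= c / Num.sqrt n%:R.
  by move=> [Sn]; rewrite geq_max => /andP[N0n _]; exact: opA.
have kn n : good n -> (k <= n)%N by move=> [_]; rewrite geq_max => /andP[].
have mD n : good n -> measurable_fun setT (fun w => quartic_deviation l%:C%C (Z n w)).
  move=> gn; have [Sn _] := gn; rewrite -lE.
  exact: (measurable_quartic_deviation (A n) (dN n Sn) (haarU n Sn)).
have ID n : good n ->
    (\int[P]_w (quartic_deviation l%:C%C (Z n w))%:E <= (K / n%:R ^+ 2)%:E)%E.
  move=> gn; have [Sn _] := gn; rewrite -lE.
  exact: (integral_quartic_deviation k0 (kn n gn) (dN n Sn) (trA n Sn) (op n gn) (haarU n Sn)).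
have nK n : 0 <= K / n%:R ^+ 2 by rewrite divr_ge0 // sqr_ge0.
split.
(* The value 0 elsewhere extends the moment bound to all [n]. The null set is found before [f] is
   introduced, so it serves all test functions at once. *)
- pose X n w := if `[< good n >] then quartic_deviation l%:C%C (Z n w) else 0.
  have mX n : measurable_fun setT (X n).
    by rewrite /X; case: asboolP => [gn|_]; [exact: mD|exact: measurable_cst].
  have X0 n w : 0 <= X n w.
    by rewrite /X; case: asboolP => // _; exact: quartic_deviation_ge0.
  have XK n : (\int[P]_w (X n w)%:E <= (K / n%:R ^+ 2)%:E)%E.
    by rewrite /X; case: asboolP => [gn|_]; [exact: ID|rewrite integral0 lee_fin].
  have := ae_cvg0 K0 mX X0 XK; apply: filterS => w Xw f cf _ e e0.
  have [r r0 fr] := emp_eig_limit (l%:C%C) kk0 e0 cf.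
  have [N1 N1P] := Xw r r0; exists (maxn N1 (maxn N0 k)) => n Sn.
  rewrite geq_max => /andP[/N1P + gn]; rewrite /X asboolT; last by split.
  exact: fr.
move=> p _ e e0.
pose M : R := 2 * (k * k)%:R * power_const (k * k) p.
have M0 : 0 <= M by rewrite mulr_ge0 ?power_const_ge0 // mulr_ge0.
have B0 : 0 < M + 1 by rewrite ltr_wpDl.
(* Makes the final bound [(M + 1) (h + h)] equal to [e / 2]; the added 1 keeps the denominator
   positive. *)
pose h := e / (4 * (M + 1)).
have h0 : 0 < h by rewrite divr_gt0 // mulr_gt0.
have h4 : 0 < h ^+ 4 by rewrite exprn_gt0.
(* For [n >= N1] one has [K <= n h^4 <= n^2 h^4], so the second error term is at most [h]. *)
pose N1 := Num.bound (K / h ^+ 4).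
have N1P : K / h ^+ 4 < N1%:R by apply: archi_boundP; rewrite divr_ge0 // ltW.
exists (maxn N1 (maxn N0 k)) => n Sn; rewrite geq_max => /andP[N1n gn'].
have gn : good n by split.
have l0 : 0 <= l by rewrite invr_ge0.
have l1 : l <= 1 by rewrite invf_le1 ?ltr0n // ler1n.
have mZ : matrix_in (measurable_fun setT) (Z n).
  exact: (measurable_output (A n) (dN n Sn) (haarU n Sn)).
have Z1 w x y : `|Z n w x y| <= 1.
  exact: (output_le1 (dN n Sn) (trA n Sn) (haarU n Sn)).
have := expectation_trace_power p l0 l1 mZ Z1 (mD n gn) (ID n gn) h0.
rewrite -/M -[(k ^ 2)%N]mulnn => /le_lt_trans; apply.
have n1 : 1 <= n%:R :> R by rewrite ler1n; case: Sn.
have Kn : K / n%:R ^+ 2 / h ^+ 3 <= h.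
  rewrite ler_pdivrMr ?exprn_gt0 // -exprS ler_pdivrMr ?exprn_gt0 ?(lt_le_trans _ n1) //.
  move: N1P; rewrite ltr_pdivrMr // => /ltW /le_trans; apply.
  rewrite mulrC ler_wpM2l ?(ltW h4) //.
  apply: (@le_trans _ _ n%:R); first by rewrite ler_nat.
  by rewrite expr2 ler_peMl // (le_trans _ n1).
apply: (@le_lt_trans _ _ ((M + 1) * (h + h))).
  apply: ler_pM => //; first by rewrite addr_ge0 ?(ltW h0) // divr_ge0 // ?exprn_ge0 // ltW.
    by rewrite lerDl.
  by rewrite lerD2l.
rewrite (_ : (M + 1) * (h + h) = e / 2); last by rewrite /h; field; rewrite gt_eqF.
by rewrite gtr_pMr // invf_lt1 // ltr1n.
Qed.
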